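(* Let $\mathbf{a}=(a_1,a_2,a_3,a_4)\in\mathbb C^4$ and let $$S_{\mathbf a}=\{(x_1,x_2,x_3)\in\mathbb C^3 : x_1^2+x_2^2+x_3^2+x_1x_2x_3=a_1x_1+a_2x_2+a_3x_3+a_4\}.$$ Consider on the smooth part of $S_{\mathbf a}$ the three holomorphic foliations $\mathcal F_i=\ker(dx_i|_{S_{\mathbf a}})$, $i=1,2,3$ (the level curves of the coordinates), and the $3$-web $(\mathcal F_1,\mathcal F_2,\mathcal F_3)$ they form on the nonempty open set of points where it is regular. Then this $3$-web is locally parallelizable (at every point of that open set) if and only if $\mathbf a=(0,0,0,4)$.
   Context: A (local) regular $3$-web on a complex surface is a triple of pairwise transversal holomorphic foliations. It is locally parallelizable if near each point there are local holomorphic coordinates $(u,v)$ in which each of the three foliations is defined by a constant $1$-form $\alpha_i du+\beta_i dv$ ($\alpha_i,\beta_i\in\mathbb C$), i.e. is a foliation by parallel lines. *)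

(* Defs.v *)
(* C := R[i] (complex numbers over a
   realType R), with its norm topology; C*C is a normed C-module, so
   'differentiable' below means complex (i.e. holomorphic) differentiability. *)
From HB Require Import structures.
From mathcomp Require Import all_boot all_order all_algebra.
From mathcomp Require Import all_classical all_reals all_analysis.
From mathcomp Require Import complex.
Import numFieldNormedType.Exports.
Set Implicit Arguments. Unset Strict Implicit. Unset Printing Implicit Defensive.
Local Open Scope ring_scope.

Section Inst.
Variable R : rcfType.
HB.instance Definition _ := GRing.ComAlgebra.copy R[i] R[i]^o.
HB.instance Definition _ := Vector.copy R[i] R[i]^o.
HB.instance Definition _ := NormedModule.copy R[i] R[i]^o.
End Inst.

Section Web.
Variable R : realType.
Local Notation C := R[i].

Definition Fa (a1 a2 a3 a4 x1 x2 x3 : C) : C :=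
  x1 ^+ 2 + x2 ^+ 2 + x3 ^+ 2 + x1 * x2 * x3
  - (a1 * x1 + a2 * x2 + a3 * x3 + a4).

Definition onS (a1 a2 a3 a4 x1 x2 x3 : C) : Prop :=
  Fa a1 a2 a3 a4 x1 x2 x3 = 0.

Definition dF1 (a1 a2 a3 a4 x1 x2 x3 : C) : C := 2%:R * x1 + x2 * x3 - a1.
Definition dF2 (a1 a2 a3 a4 x1 x2 x3 : C) : C := 2%:R * x2 + x1 * x3 - a2.
Definition dF3 (a1 a2 a3 a4 x1 x2 x3 : C) : C := 2%:R * x3 + x1 * x2 - a3.

Definition tangent (a1 a2 a3 a4 x1 x2 x3 v1 v2 v3 : C) : Prop :=
  dF1 a1 a2 a3 a4 x1 x2 x3 * v1 + dF2 a1 a2 a3 a4 x1 x2 x3 * v2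
  + dF3 a1 a2 a3 a4 x1 x2 x3 * v3 = 0.

Definition smooth_pt (a1 a2 a3 a4 x1 x2 x3 : C) : Prop :=
  onS a1 a2 a3 a4 x1 x2 x3 /\
  ~ [/\ dF1 a1 a2 a3 a4 x1 x2 x3 = 0, dF2 a1 a2 a3 a4 x1 x2 x3 = 0
      & dF3 a1 a2 a3 a4 x1 x2 x3 = 0].

(* x is a point where the 3-web (F_1,F_2,F_3), F_i = ker (dx_i|S), is regular:
   x is a smooth point of S_a and the restrictions of dx_i, dx_j to T_x S_a
   are linearly independent for i <> j, i.e. ker(dx_i|T) and ker(dx_j|T)
   meet only in 0 (pairwise transversality; this also forces dx_i|T <> 0). *)
Definition web_regular (a1 a2 a3 a4 x1 x2 x3 : C) : Prop :=
  smooth_pt a1 a2 a3 a4 x1 x2 x3 /\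
  forall v1 v2 v3 : C, tangent a1 a2 a3 a4 x1 x2 x3 v1 v2 v3 ->
    [/\ (v1 = 0 /\ v2 = 0 -> v3 = 0),
        (v1 = 0 /\ v3 = 0 -> v2 = 0)
      & (v2 = 0 /\ v3 = 0 -> v1 = 0)].

(* The 3-web is locally parallelizable near x: there are local holomorphic
   coordinates (u,v) on S_a near x, given by their inverse, a holomorphic
   parametrization psi = (psi1,psi2,psi3) : W -> S_a (W open in C^2,
   psi injective holomorphic immersion, psi(w0) = x), and constants
   (alpha_i, beta_i) <> (0,0) such that, at every point of W, the foliation
   F_i = ker(dx_i|S) is defined by the constant 1-form alpha_i du + beta_i dv,
   i.e. ker d(x_i o psi)(w) = ker (alpha_i du + beta_i dv). *)
Definition loc_parallelizable (a1 a2 a3 a4 x1 x2 x3 : C) : Prop :=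
  exists (W : set (C * C)%type) (w0 : (C * C)%type)
         (psi1 psi2 psi3 : (C * C)%type -> C)
         (al1 be1 al2 be2 al3 be3 : C),
  open W /\ W w0 /\
      [/\ psi1 w0 = x1, psi2 w0 = x2 & psi3 w0 = x3] /\
      (forall w, W w -> onS a1 a2 a3 a4 (psi1 w) (psi2 w) (psi3 w)) /\
      (forall w w', W w -> W w' ->
         [/\ psi1 w = psi1 w', psi2 w = psi2 w' & psi3 w = psi3 w'] -> w = w') /\
      (forall w, W w ->
         [/\ differentiable psi1 w, differentiable psi2 w,
             differentiable psi3 w &
             forall h : (C * C)%type,
               [/\ 'd psi1 w h = 0, 'd psi2 w h = 0 & 'd psi3 w h = 0] ->
               h = 0]) /\
      [/\ (al1, be1) <> (0, 0), (al2, be2) <> (0, 0) & (al3, be3) <> (0, 0)] /\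
      (forall w, W w -> forall h : (C * C)%type,
         [/\ 'd psi1 w h = 0 <-> al1 * h.1 + be1 * h.2 = 0,
             'd psi2 w h = 0 <-> al2 * h.1 + be2 * h.2 = 0 &
             'd psi3 w h = 0 <-> al3 * h.1 + be3 * h.2 = 0]).

End Web.

(* Main.v *)
(* Write F_i for the partial derivatives of the cubic; the web is regular where
   F_1 F_2 F_3 <> 0.

   Parallelizability at a regular point yields affine parameters (s,t) in which
   x_1 = f(s), x_2 = g(t), while the derivatives of x_3 = H(s,t) are
   proportional.  Differentiating the equation of S_a gives
   nu F_1 f'(s) = mu F_2 g'(t).  This relation makes g' itself differentiable,
   so no Cauchy theory is needed, and differentiating it in t and then in s
   produces a polynomial (the web curvature) that vanishes at x.

   The curvature vanishes at all regular points, hence by continuity on the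
   curve F_3 = 0, where it equals 2 F_1^2 F_2^2 (x_1 F_1 - x_2 F_2).  On a
   generic slice x_1 = s that curve consists of two points, the roots t of the
   discriminant Delta(s,t); there F_2 and x_1 F_1 - x_2 F_2 do not vanish, so
   F_1 = 0, which makes Delta(s,.) proportional to its derivative in s.  Comparing
   coefficients gives a = (0,0,0,4).

   Conversely the Cayley cubic is uniformized by x_1 = -2 cosh u,
   x_2 = -2 cosh v, x_3 = -2 cosh (u + v). *)
Require Import Defs.
From HB Require Import structures.
From mathcomp Require Import all_boot all_order all_algebra.
From mathcomp Require Import all_classical all_reals all_analysis.
From mathcomp Require Import complex ring lra zify.
Import numFieldNormedType.Exports.
Import Order.TTheory GRing.Theory Num.Theory.
Local Open Scope ring_scope.
Local Open Scope classical_set_scope.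
Set Implicit Arguments. Unset Strict Implicit. Unset Printing Implicit Defensive.

(** * Curvature of the web *)

(* With Z = F3 d/dx1 - F1 d/dx3 (tangent to S_a and to the fibres of x2),
   N = x3 F2 F3 - x2 F2^2 - 2 F1 F3 + x1 F1 F2 and D = F1 F2 F3, this is
   Z(N) D - N Z(D); the variables Zi are Z(Fi), and Z(x1) = F3, Z(x3) = - F1. *)
Definition web_curv (K : pzRingType) (x1 x2 x3 F1 F2 F3 : K) : K :=
  let Z1 := 2 * F3 - x2 * F1 in
  let Z2 := x3 * F3 - x1 * F1 in
  let Z3 := x2 * F3 - 2 * F1 in
  (- F1 * F2 * F3 + x3 * (Z2 * F3 + F2 * Z3) - 2 * x2 * F2 * Z2
   - 2 * (Z1 * F3 + F1 * Z3) + F3 * F1 * F2 + x1 * (Z1 * F2 + F1 * Z2))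
    * (F1 * F2 * F3)
  - (x3 * F2 * F3 - x2 * F2 ^+ 2 - 2 * F1 * F3 + x1 * F1 * F2)
    * (Z1 * F2 * F3 + F1 * Z2 * F3 + F1 * F2 * Z3).

Lemma scaleK (K : numFieldType) (a b : K) : a *: b = a * b.
Proof. by []. Qed.

Lemma near_norm_lt (K : numFieldType) (r x : K) :
  `|x| < r -> \forall y \near x, `|y| < r.
Proof.
move=> xr; have r0 : 0 < r - `|x| by rewrite subr_gt0.
near=> y.
have yx : `|x - y| < r - `|x| by near: y; exact: (@cvgr_dist_lt _ K).
rewrite -[y](subrK x) (le_lt_trans (ler_normD _ _))//.
by rewrite -ltrBrDr distrC.
Unshelve. all: by end_near. Qed.

Lemma is_derive_near_unique (K : numFieldType) (V W : normedModType K)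
  (f g : V -> W) (x v : V) (df dg : W) :
  is_derive x v f df -> is_derive x v g dg -> (\near x, f x = g x) -> df = dg.
Proof.
by move=> hf hg e; rewrite -(@derive_val _ _ _ _ _ _ _ hf)
   -(@derive_val _ _ _ _ _ _ _ hg); exact: near_eq_derive.
Qed.

Section Curv.
Variable (K : numFieldType) (a1 a2 a3 a4 : K).
(** [f], [g] and [H] are the coordinates x1, x2, x3 in affine parameters (s, t). The relation [hst]
    says that the constant direction (nu, - mu) is tangent to the level curves of x3. *)
Variables (f g f' g' : K -> K) (H Hs Ht : K -> K -> K) (r mu nu : K).
Hypotheses (r0 : 0 < r) (mu0 : mu != 0).
Hypothesis hf : forall s : K, `|s| < r -> is_derive s (1 : K) f (f' s).
Hypothesis hg : forall s : K, `|s| < r -> is_derive s (1 : K) g (g' s).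
Hypothesis hHs : forall s t : K, `|s| < r -> `|t| < r ->
  is_derive s (1 : K) (H^~ t) (Hs s t).
Hypothesis hHt : forall s t : K, `|s| < r -> `|t| < r ->
  is_derive t (1 : K) (H s) (Ht s t).
Hypothesis hst : forall s t : K, `|s| < r -> `|t| < r -> nu * Hs s t = mu * Ht s t.
Hypothesis onF : forall s t : K, `|s| < r -> `|t| < r ->
  f s ^+ 2 + g t ^+ 2 + H s t ^+ 2 + f s * g t * H s t
  - (a1 * f s + a2 * g t + a3 * H s t + a4) = 0.
Let F1 s t := 2 * f s + g t * H s t - a1.
Let F2 s t := 2 * g t + f s * H s t - a2.
Let F3 s t := 2 * H s t + f s * g t - a3.
Hypotheses (f'0 : f' 0 != 0) (g'0 : g' 0 != 0) (F20 : F2 0 0 != 0).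

Let zr : `|0 : K| < r. Proof. by rewrite normr0. Qed.

Let eq_s s t : `|s| < r -> `|t| < r -> F1 s t * f' s + F3 s t * Hs s t = 0.
Proof.
move=> sr tr; have h1 := hf sr; have h2 := hHs sr tr.
pose q (s : K) := f s * f s + g t * g t + H s t * H s t + f s * g t * H s t
  - (a1 * f s + a2 * g t + a3 * H s t + a4).
have hq : is_derive s (1 : K) q (F1 s t * f' s + F3 s t * Hs s t).
  apply: is_derive_eq.
  rewrite /F1 /F3 ?scaleK; ring.
apply: (is_derive_near_unique hq (is_derive_cst (0 : K) s (1 : K))).
near=> y; rewrite /q -[RHS](@onF y t)//.
by near: y; exact: near_norm_lt.
Unshelve. all: by end_near. Qed.

Let eq_t s t : `|s| < r -> `|t| < r -> F2 s t * g' t + F3 s t * Ht s t = 0.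
Proof.
move=> sr tr; have h1 := hg tr; have h2 := hHt sr tr.
pose q (t : K) := f s * f s + g t * g t + H s t * H s t + f s * g t * H s t
  - (a1 * f s + a2 * g t + a3 * H s t + a4).
have hq : is_derive t (1 : K) q (F2 s t * g' t + F3 s t * Ht s t).
  apply: is_derive_eq.
  rewrite /F2 /F3 ?scaleK; ring.
apply: (is_derive_near_unique hq (is_derive_cst (0 : K) t (1 : K))).
near=> y; rewrite /q -[RHS](@onF s y)//.
by near: y; exact: near_norm_lt.
Unshelve. all: by end_near. Qed.

(** Tangency along s and t reads F1 f' = - F3 Hs and F2 g' = - F3 Ht; [hst] makes the right-hand
    sides proportional. *)
Let eq_fg s t : `|s| < r -> `|t| < r ->
  nu * F1 s t * f' s = mu * F2 s t * g' t.
Proof.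
move=> sr tr.
have e1 := eq_s sr tr; have e2 := eq_t sr tr; have e3 := hst sr tr.
have -> : nu * F1 s t * f' s = - F3 s t * (nu * Hs s t).
  by apply/eqP; rewrite -subr_eq0 -[eqbRHS](mulr0 nu) -e1; apply/eqP; ring.
rewrite e3.
by apply/eqP; rewrite -subr_eq0 -[eqbRHS](mulr0 (- mu)) -e2; apply/eqP; ring.
Qed.

Let dF1 s t : `|s| < r -> `|t| < r ->
  is_derive t (1 : K) (F1 s) (g' t * H s t + g t * Ht s t).
Proof.
move=> sr tr; have h1 := hg tr; have h2 := hHt sr tr.
by apply: is_derive_eq; rewrite ?scaleK; ring.
Qed.

Let dF2 s t : `|s| < r -> `|t| < r ->
  is_derive t (1 : K) (F2 s) (2 * g' t + f s * Ht s t).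
Proof.
move=> sr tr; have h1 := hg tr; have h2 := hHt sr tr.
by apply: is_derive_eq; rewrite ?scaleK; ring.
Qed.

(* The web equation expresses [g'] rationally through differentiable functions:
   this bootstraps first-order regularity into second-order regularity. *)
Let der_g' : exists g2, is_derive (0 : K) 1 g' g2.
Proof.
have h1 := dF1 zr zr; have h2 := dF2 zr zr.
have [d1] := h1; have [d2] := h2 => _ _.
have dV : derivable (fun t => (F2 0 t)^-1) 0 1 by exact: derivableV.
have /derivableP hV := dV.
pose q t := (nu / mu * f' 0) * (F1 0 t * (F2 0 t)^-1).
have hq : is_derive (0 : K) (1 : K) q ('D_1 q 0).
  by apply: derivableP; apply: derivableM => //; exact: derivableM.
exists ('D_1 q 0); apply: near_eq_is_derive hq.
have F2c : {for 0, continuous (F2 0)}.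
  apply: differentiable_continuous; exact/derivable1_diffP.
near=> t.
have F2t : F2 0 t != 0.
  near: t; have := @cvgr_neq0 _ _ _ _ _ (F2 0) _ F2c F20; exact.
have tr : `|t| < r by near: t; exact: near_norm_lt.
apply: (mulfI (mulf_neq0 mu0 F2t)); rewrite -eq_fg// /q; field.
by rewrite F2t.
Unshelve. all: by end_near. Qed.

(** Differentiating [eq_fg] in t at t = 0 and eliminating nu f' and Ht leaves g'(0)^2 N(s) = g2
    D(s), whose coefficients do not depend on s. Hence N and D have proportional values and
    s-derivatives at 0, and the resulting determinant is the curvature up to a factor. *)
Lemma web_curv_eq0 :
  web_curv (f 0) (g 0) (H 0 0) (F1 0 0) (F2 0 0) (F3 0 0) = 0.
Proof.
have [g2 hg2] := der_g'.
pose N s := H s 0 * F2 s 0 * F3 s 0 - g 0 * (F2 s 0 * F2 s 0)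
  - 2 * F1 s 0 * F3 s 0 + f s * F1 s 0 * F2 s 0.
pose D s := F1 s 0 * F2 s 0 * F3 s 0.
have eN s : `|s| < r -> g' 0 ^+ 2 * N s = g2 * D s.
  move=> sr.
  have h1 := dF1 sr zr; have h2 := dF2 sr zr.
  have e : nu * (g' 0 * H s 0 + g 0 * Ht s 0) * f' s =
    mu * ((2 * g' 0 + f s * Ht s 0) * g' 0 + F2 s 0 * g2).
    pose l t := nu * F1 s t * f' s.
    pose k t := mu * F2 s t * g' t.
    have hl : is_derive (0 : K) (1 : K) l (nu * (g' 0 * H s 0 + g 0 * Ht s 0) * f' s).
      by apply: is_derive_eq; rewrite ?scaleK; ring.
    have hk : is_derive (0 : K) (1 : K) k
        (mu * ((2 * g' 0 + f s * Ht s 0) * g' 0 + F2 s 0 * g2)).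
      by apply: is_derive_eq; rewrite ?scaleK; ring.
    apply: (is_derive_near_unique hl hk).
    near=> t; apply: eq_fg => //; near: t; exact: near_norm_lt.
  have e1 := eq_fg sr zr; have e2 := eq_t sr zr.
  apply: (mulfI mu0).
  pose T := F1 s 0 * F3 s 0.
  (* Certificate of the elimination: F1 F3 times the t-derivative of [eq_fg], corrected by a
     multiple of [eq_fg], which removes nu f', and a multiple of [eq_t], which removes Ht. *)
  have e3 : mu * (g' 0 ^+ 2 * N s) - mu * (g2 * D s) =
    T * (nu * (g' 0 * H s 0 + g 0 * Ht s 0) * f' s -
      mu * ((2 * g' 0 + f s * Ht s 0) * g' 0 + F2 s 0 * g2))
    - F3 s 0 * (g' 0 * H s 0 + g 0 * Ht s 0)
        * (nu * F1 s 0 * f' s - mu * F2 s 0 * g' 0)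
    + (mu * F1 s 0 * f s * g' 0 - mu * F2 s 0 * g' 0 * g 0)
        * (F2 s 0 * g' 0 + F3 s 0 * Ht s 0).
    by rewrite /N /D /T; ring.
  by apply/eqP; rewrite -subr_eq0 e3 e e1 e2 !subrr; apply/eqP; ring.
have h1 := hf zr; have h2 := hHs zr zr.
have d1 : is_derive (0 : K) (1 : K) (F1^~ 0) (2 * f' 0 + g 0 * Hs 0 0).
  by apply: is_derive_eq; rewrite ?scaleK; ring.
have d2 : is_derive (0 : K) (1 : K) (F2^~ 0) (f' 0 * H 0 0 + f 0 * Hs 0 0).
  by apply: is_derive_eq; rewrite ?scaleK; ring.
have d3 : is_derive (0 : K) (1 : K) (F3^~ 0) (2 * Hs 0 0 + f' 0 * g 0).
  by apply: is_derive_eq; rewrite ?scaleK; ring.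
pose u := f' 0; pose k := Hs 0 0.
pose k1 := 2 * u + g 0 * k; pose k2 := u * H 0 0 + f 0 * k.
pose k3 := 2 * k + u * g 0.
have hN : is_derive (0 : K) (1 : K) N (k * F2 0 0 * F3 0 0
    + H 0 0 * (k2 * F3 0 0 + F2 0 0 * k3) - 2 * g 0 * F2 0 0 * k2
    - 2 * (k1 * F3 0 0 + F1 0 0 * k3) + u * F1 0 0 * F2 0 0
    + f 0 * (k1 * F2 0 0 + F1 0 0 * k2)).
  by rewrite /N; apply: is_derive_eq;
    rewrite /k1 /k2 /k3 /u /k ?scaleK; ring.
have hD : is_derive (0 : K) (1 : K) D (k1 * F2 0 0 * F3 0 0
    + F1 0 0 * k2 * F3 0 0 + F1 0 0 * F2 0 0 * k3).
  by rewrite /D; apply: is_derive_eq;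
    rewrite /k1 /k2 /k3 /u /k ?scaleK; ring.
set N' := (X in is_derive _ _ N X) in hN.
set D' := (X in is_derive _ _ D X) in hD.
have e' : g' 0 ^+ 2 * N' = g2 * D'.
  have hN2 : is_derive (0 : K) (1 : K) (fun s => g' 0 ^+ 2 * N s) (g' 0 ^+ 2 * N').
    by apply: is_derive_eq; rewrite ?scaleK; ring.
  have hD2 : is_derive (0 : K) (1 : K) (fun s => g2 * D s) (g2 * D').
    by apply: is_derive_eq; rewrite ?scaleK; ring.
  apply: (is_derive_near_unique hN2 hD2).
  by near=> t; apply: eN; near: t; exact: near_norm_lt.
have e0 := eN 0 zr.
(* Only c = g'(0)^2 is cancelled, so N' D - N D' = 0 follows without dividing by D or g2. *)
have cross (c n0 d0 n d : K) :
    c != 0 -> c * n = g2 * d -> c * n0 = g2 * d0 -> n * d0 - n0 * d = 0.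
  move=> c0 h h0; apply: (mulfI c0).
  by rewrite mulr0 mulrBr !mulrA h h0 mulrAC subrr.
have eND := cross _ _ _ _ _ (expf_neq0 2 g'0) e' e0.
have ek : F3 0 0 * k + F1 0 0 * u = 0 by rewrite addrC eq_s.
(* The same determinant, with the s-derivatives of x1 and x3 as free variables u and k, in which it
   is linear. By [ek] the actual pair is parallel to (F3, - F1), the direction Z of [web_curv]. *)
pose E (u k : K) :=
  let k1 := 2 * u + g 0 * k in let k2 := u * H 0 0 + f 0 * k in
  let k3 := 2 * k + u * g 0 in
  (k * F2 0 0 * F3 0 0
    + H 0 0 * (k2 * F3 0 0 + F2 0 0 * k3) - 2 * g 0 * F2 0 0 * k2
    - 2 * (k1 * F3 0 0 + F1 0 0 * k3) + u * F1 0 0 * F2 0 0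
    + f 0 * (k1 * F2 0 0 + F1 0 0 * k2)) * D 0
  - N 0 * (k1 * F2 0 0 * F3 0 0
    + F1 0 0 * k2 * F3 0 0 + F1 0 0 * F2 0 0 * k3).
have Ecurv (v w : K) : v * web_curv (f 0) (g 0) (H 0 0) (F1 0 0) (F2 0 0) (F3 0 0) =
    F3 0 0 * E v w - E 0 1 * (F3 0 0 * w + F1 0 0 * v).
  rewrite /web_curv /E /N /D.
  move: (F1 0 0) (F2 0 0) (F3 0 0) (f 0) (g 0) (H 0 0)
    => G1 G2 G3 x1 x2 x3.
  ring.
have Euk : E u k = 0 by [].
by apply: (mulfI f'0); rewrite -/u (Ecurv u k) Euk ek !mulr0 subrr.
Unshelve. all: by end_near. Qed.

End Curv.

(** * Complex mean value argument *)

Lemma is_derive_line (K : numFieldType) (V W : normedModType K)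
  (psi : V -> W) (p e : V) (s : K) (d : W) :
  is_derive (p + s *: e) e psi d ->
  is_derive s (1 : K) (fun s => psi (p + s *: e)) d.
Proof.
move=> [dpsi <-].
have e1 : (fun h => h^-1 *: (((fun s => psi (p + s *: e)) \o shift s) (h *: (1 : K))
    - psi (p + s *: e))) =
  (fun h => h^-1 *: ((psi \o shift (p + s *: e)) (h *: e) - psi (p + s *: e))).
  apply/funext => h /=; by rewrite [h *: _]mulr1 scalerDl addrCA.
by split; [rewrite /derivable e1|rewrite /derive e1].
Qed.

Section complex_mean_value.
Variable R : realType.
Local Open Scope complex_scope.

Lemma norm_real_complex (x : R) : `|x%:C| = `|x|%:C.
Proof. by rewrite normc_def /= expr0n addr0 sqrtr_sqr. Qed.

Lemma norm_Re_le (z : R[i]) : `|complex.Re z|%:C <= `|z|.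
Proof.
rewrite normc_def lecR -sqrtr_sqr ler_wsqrtr// lerDl; exact: sqr_ge0.
Qed.

Lemma norm_Im_le (z : R[i]) : `|complex.Im z|%:C <= `|z|.
Proof.
rewrite normc_def lecR -sqrtr_sqr ler_wsqrtr// lerDr; exact: sqr_ge0.
Qed.

Lemma real_complex_continuous : continuous (fun x : R => x%:C : R[i]).
Proof.
move=> x; apply/(@cvgrPdist_lt _ R[i]) => e e0.
have e0R : 0 < complex.Re e by move: e0; rewrite ltcE /= => /andP[].
have -> : e = (complex.Re e)%:C by rewrite RRe_real// gtr0_real.
near=> y; rewrite -rmorphB norm_real_complex ltcR.
by near: y; exact: (@cvgr_dist_lt _ R).
Unshelve. all: by end_near. Qed.

(** [L] stands for the real or the imaginary part. The difference quotient along the real line y t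
    is t times the complex one, and [L] does not increase norms. *)
Lemma is_derive_real_part (L : {additive R[i] -> R}) (phi : R[i] -> R[i])
    (t : R[i]) (x : R) :
  (forall z, `|L z|%:C <= `|z|) -> is_derive (x%:C * t) (1 : R[i]) phi 0 ->
  is_derive x (1 : R) (fun y : R => L (phi (y%:C * t))) 0.
Proof.
move=> hL [dphi dphi0].
have : h^-1 *: ((phi \o shift (x%:C * t)) (h *: (1 : R[i])) - phi (x%:C * t))
    @[h --> 0^'] --> (0 : R[i]).
  by rewrite -[X in _ --> X]dphi0; exact: dphi.
move/(@cvgrPdist_lt _ R[i]) => dq.
suff : h^-1 *: (((fun y : R => L (phi (y%:C * t))) \o shift x) (h *: (1 : R))
      - L (phi (x%:C * t))) @[h --> 0^'] --> (0 : R).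
  move=> c; split; first by apply/cvg_ex; exists 0.
  exact/cvg_lim.
apply/(@cvgrPdist_lt _ R) => e e0.
(* For t = 0 the function is constant; otherwise the complex quotient is taken within e / |t|, to
   absorb the factor t. *)
have [->|t0] := eqVneq t 0.
  by near=> h; rewrite /= !mulr0 subrr scaler0 subr0 normr0.
have e'0 : 0 < e%:C / `|t| by rewrite divr_gt0 ?normr_gt0// ltcE /= eqxx.
have /= := dq _ e'0.
rewrite near_withinE => near1.
have c0 : (fun h : R => h%:C * t) @ (0 : R) --> (0 : R[i]).
  rewrite -[X in _ --> X](mul0r t); apply: cvgMl.
  exact: (@real_complex_continuous 0).
have {near1} near2 := c0 _ near1.
rewrite near_withinE; near=> h => h0.
have hC0 : h%:C != 0 by rewrite eq_complex /= eqxx andbT.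
have ht0 : h%:C * t != 0 by rewrite mulf_neq0.
have : h%:C * t != 0 -> `|0 - (h%:C * t)^-1 *:
  (phi (h%:C * t *: (1 : R[i]) + x%:C * t) - phi (x%:C * t))| < e%:C / `|t|.
  by near: h.
move=> /(_ ht0).
have -> : h%:C * t *: (1 : R[i]) + x%:C * t = (h + x)%:C * t.
  by rewrite [_ *: _]mulr1 -mulrDl -rmorphD.
rewrite [h *: (1 : R)]mulr1 -raddfB.
set d := phi _ - _.
rewrite !sub0r !normrN [(_)^-1 *: d]/((_)^-1 * d) [h^-1 *: _]/(h^-1 * _).
rewrite !normrM !normfV normrM norm_real_complex.
rewrite mulrC ltr_pdivrMr ?mulr_gt0 ?normr_gt0//; last first.
  by rewrite ltcE /= eqxx normr_gt0.
rewrite [`|h|%:C * _]mulrC mulrA divfK ?normr_eq0// => dlt.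
rewrite mulrC ltr_pdivrMr ?normr_gt0// -ltcR rmorphM/=.
exact: le_lt_trans (hL d) dlt.
Unshelve. all: by end_near. Qed.

(** On the segment from 0 to t the real mean value theorem applies to the real and imaginary parts
    separately. *)
Lemma derive_eq0_cst_disc (phi : R[i] -> R[i]) (r : R[i]) :
  (forall t : R[i], `|t| < r -> is_derive t (1 : R[i]) phi 0) ->
  forall t : R[i], `|t| < r -> phi t = phi 0.
Proof.
move=> dphi t tr.
have part (L : {additive R[i] -> R}) :
    (forall z, `|L z|%:C <= `|z|) -> L (phi t) = L (phi 0).
  move=> hL.
  pose F (y : R) : R := L (phi (y%:C * t)).
  have dL (x : R) : x \in `[0, 1]%R -> is_derive x (1 : R) F 0.
    rewrite in_itv/= => /andP[x0 x1]; apply: is_derive_real_part => //.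
    apply: dphi; rewrite normrM norm_real_complex (le_lt_trans _ tr)//.
    by rewrite ler_piMl// (_ : 1 = 1%:C)// lecR ger0_norm.
  have dF (x : R) : x \in `]0, 1[%R -> is_derive x (1 : R) F ((fun=> 0) x).
    by move=> x01; apply: dL; exact: subset_itv_oo_cc.
  have cF : {within `[0, 1], continuous F}.
    by apply: derivable_within_continuous => x x01; have [] := dL x x01.
  have [c _] := MVT (@ltr01 R) dF cF.
  rewrite mul0r => /subr0_eq.
  by rewrite /F /= mul0r mul1r.
have eRe := part (@complex.Re R : {additive R[i] -> R}) norm_Re_le.
have eIm := part (@complex.Im R : {additive R[i] -> R}) norm_Im_le.
by apply/eqP; rewrite eq_complex; apply/andP; split; apply/eqP.
Qed.

End complex_mean_value.

(** * Parallelizable webs are flat *)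

Lemma cubic_tangent (K : numFieldType) (V : normedModType K)
    (a1 a2 a3 a4 : K) (p1 p2 p3 : V -> K) (x h : V) (d1 d2 d3 : K) :
  is_derive x h p1 d1 -> is_derive x h p2 d2 -> is_derive x h p3 d3 ->
  (\forall y \near x, p1 y ^+ 2 + p2 y ^+ 2 + p3 y ^+ 2 + p1 y * p2 y * p3 y
    - (a1 * p1 y + a2 * p2 y + a3 * p3 y + a4) = 0) ->
  (2 * p1 x + p2 x * p3 x - a1) * d1 + (2 * p2 x + p1 x * p3 x - a2) * d2
    + (2 * p3 x + p1 x * p2 x - a3) * d3 = 0.
Proof.
move=> h1 h2 h3 near0.
pose q y := p1 y * p1 y + p2 y * p2 y + p3 y * p3 y + p1 y * p2 y * p3 y
   - (a1 * p1 y + a2 * p2 y + a3 * p3 y + a4).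
have hq : is_derive x h q
    ((2 * p1 x + p2 x * p3 x - a1) * d1 + (2 * p2 x + p1 x * p3 x - a2) * d2
    + (2 * p3 x + p1 x * p2 x - a3) * d3).
  by apply: is_derive_eq; rewrite ?scaleK; ring.
exact: (is_derive_near_unique hq (is_derive_cst (0 : K) x h) near0).
Qed.

Lemma is_derive_diff (K : numFieldType) (V W : normedModType K) (f : V -> W)
  (x v : V) : differentiable f x -> is_derive x v f ('d f x v).
Proof. by move=> df; split; [exact: diff_derivable|rewrite deriveE]. Qed.

Lemma linear_comb (K : numFieldType) (V : normedModType K)
    (L : {linear V -> K}) (a b : K) (u v : V) :
  L (a *: u - b *: v) = a * L u - b * L v.
Proof. by rewrite linearB (linearZ_LR L a u) (linearZ_LR L b v). Qed.

Section Flat.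
Variables (K : numFieldType) (a1 a2 a3 a4 : K).
Hypothesis cstK : forall (phi : K -> K) (r : K),
  (forall t : K, `|t| < r -> is_derive t (1 : K) phi 0) ->
  forall t : K, `|t| < r -> phi t = phi 0.
Let F1 (x1 x2 x3 : K) := 2 * x1 + x2 * x3 - a1.
Let F2 (x1 x2 x3 : K) := 2 * x2 + x1 * x3 - a2.
Let F3 (x1 x2 x3 : K) := 2 * x3 + x1 * x2 - a3.
Variables (W : set (K * K)) (w0 : K * K) (p1 p2 p3 : K * K -> K).
Variables (al1 be1 al2 be2 al3 be3 : K).
Hypotheses (oW : open W) (Ww0 : W w0).
Hypothesis onW : forall w, W w ->
  p1 w ^+ 2 + p2 w ^+ 2 + p3 w ^+ 2 + p1 w * p2 w * p3 w
    - (a1 * p1 w + a2 * p2 w + a3 * p3 w + a4) = 0.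
Hypothesis dW : forall w, W w ->
  [/\ differentiable p1 w, differentiable p2 w, differentiable p3 w &
    forall h : K * K,
      [/\ 'd p1 w h = 0, 'd p2 w h = 0 & 'd p3 w h = 0] -> h = 0].
Hypotheses (n1 : (al1, be1) <> (0, 0)) (n2 : (al2, be2) <> (0, 0)).
Hypothesis kW : forall w, W w -> forall h : K * K,
  [/\ 'd p1 w h = 0 <-> al1 * h.1 + be1 * h.2 = 0,
      'd p2 w h = 0 <-> al2 * h.1 + be2 * h.2 = 0 &
      'd p3 w h = 0 <-> al3 * h.1 + be3 * h.2 = 0].
Hypotheses (G1 : F1 (p1 w0) (p2 w0) (p3 w0) != 0)
  (G2 : F2 (p1 w0) (p2 w0) (p3 w0) != 0)
  (G3 : F3 (p1 w0) (p2 w0) (p3 w0) != 0).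

(** The vectors u and v span the kernels of the second and first constant forms. In the parameters
    w0 + s u + t v, x1 is therefore constant in t and x2 constant in s (by [cstK]), which is the
    setting of [web_curv_eq0]. *)
Lemma flat_web_curv : web_curv (p1 w0) (p2 w0) (p3 w0)
  (F1 (p1 w0) (p2 w0) (p3 w0)) (F2 (p1 w0) (p2 w0) (p3 w0))
  (F3 (p1 w0) (p2 w0) (p3 w0)) = 0.
Proof.
have tan w h : W w ->
    F1 (p1 w) (p2 w) (p3 w) * 'd p1 w h
  + F2 (p1 w) (p2 w) (p3 w) * 'd p2 w h
  + F3 (p1 w) (p2 w) (p3 w) * 'd p3 w h = 0.
  move=> Ww; have [d1 d2 d3 _] := dW Ww.
  apply: (cubic_tangent (is_derive_diff h d1) (is_derive_diff h d2)
    (is_derive_diff h d3) (a4 := a4)).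
  near=> y; apply: onW; near: y; exact: open_nbhs_nbhs.
have [d1 d2 d3 imm] := dW Ww0.
have tan0 h := tan w0 h Ww0.
have ker h := kW Ww0 h.
(* If the first two forms were proportional, v would be killed by dx1 and dx2, hence by dx3 because
   F3 is nonzero, against immersivity. The same argument with u and F1 separates the last two
   forms. *)
have det12 : al1 * be2 - be1 * al2 != 0.
  apply: contra_notN n1 => /eqP det.
  have [[_ k1] [_ k2] _] := ker (be1, - al1).
  have z1 := k1 ltac:(rewrite /=; ring).
  have z2 : 'd p2 w0 (be1, - al1) = 0.
    by apply: k2; rewrite /= -[RHS]oppr0 -det; ring.
  have := tan0 (be1, - al1); rewrite z1 z2 !mulr0 !add0r => /eqP.
  rewrite mulf_eq0 (negbTE G3)/= => /eqP z3.
  by have [-> /eqP] := imm _ (And3 z1 z2 z3); rewrite oppr_eq0 => /eqP ->.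
have det23 : al3 * be2 - be3 * al2 != 0.
  apply: contra_notN n2 => /eqP det.
  have [_ [_ k2] [_ k3]] := ker (be2, - al2).
  have z2 := k2 ltac:(rewrite /=; ring).
  have z3 : 'd p3 w0 (be2, - al2) = 0.
    by apply: k3; rewrite /= -[RHS]det; ring.
  have := tan0 (be2, - al2); rewrite z2 z3 !mulr0 !addr0 => /eqP.
  rewrite mulf_eq0 (negbTE G1)/= => /eqP z1.
  by have [-> /eqP] := imm _ (And3 z1 z2 z3); rewrite oppr_eq0 => /eqP ->.
pose u : K * K := (be2, - al2); pose v : K * K := (be1, - al1).
pose P (s t : K) : K * K := w0 + s *: u + t *: v.
have [r r0 rW] : exists2 r : K, 0 < r &
    forall s t : K, `|s| < r -> `|t| < r -> W (P s t).
  have cP : (fun st : K * K => P st.1 st.2) @ ((0 : K), (0 : K)) --> w0.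
    rewrite -[X in _ --> X](_ : P 0 0 = w0); last first.
      by rewrite /P !scale0r !addr0.
    apply: cvgD; first (apply: cvgD; first exact: cvg_cst).
      by apply: cvgZl; exact: cvg_fst.
    by apply: cvgZl; exact: cvg_snd.
  have /nbhs_ballP[r /= r0 hr] := cP _ (open_nbhs_nbhs (conj oW Ww0)).
  exists r => // s t sr tr; apply: (hr (s, t)); split => /=;
    by rewrite -ball_normE /= sub0r normrN.
have PE s t : P s t = w0 + t *: v + s *: u by rewrite /P addrAC.
have P00 : P 0 0 = w0 by rewrite /P !scale0r !addr0.
have zr : `|0 : K| < r by rewrite normr0.
have ds (p : K * K -> K) (s t : K) : differentiable p (P s t) ->
    is_derive s (1 : K) (fun s => p (P s t)) ('d p (P s t) u).
  rewrite PE => dp.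
  have -> : (fun s => p (P s t)) = (fun s => p (w0 + t *: v + s *: u)).
    by apply/funext => z; rewrite PE.
  by apply: is_derive_line; exact: is_derive_diff.
have dt (p : K * K -> K) (s t : K) : differentiable p (P s t) ->
    is_derive t (1 : K) (fun t => p (P s t)) ('d p (P s t) v).
  by move=> dp; apply: is_derive_line; exact: is_derive_diff.
have p1E s t : `|s| < r -> `|t| < r -> p1 (P s t) = p1 (P s 0).
  move=> sr; suff ph y : `|y| < r -> is_derive y (1 : K) (fun t => p1 (P s t)) 0.
    by move=> tr; exact: (cstK ph tr).
  move: y => {}t tr.
  have Wst := rW s t sr tr.
  have [dp _ _ _] := dW Wst; have [[_ k] _ _] := kW Wst v.
  by rewrite -k /=; [exact: dt|ring].
have p2E s t : `|s| < r -> `|t| < r -> p2 (P s t) = p2 (P 0 t).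
  move=> sr tr.
  suff ph y : `|y| < r -> is_derive y (1 : K) (fun s => p2 (P s t)) 0.
    exact: (cstK ph sr).
  move: y => {sr}s sr.
  have Wst := rW s t sr tr.
  have [_ dp _ _] := dW Wst; have [_ [_ k] _] := kW Wst u.
  by rewrite -k /=; [exact: ds|ring].
have W0 s : `|s| < r -> W (P s 0) by move=> sr; exact: rW.
have h1 s : `|s| < r ->
    is_derive s (1 : K) (fun s => p1 (P s 0)) ('d p1 (P s 0) u).
  by move=> sr; apply: ds; have [] := dW (W0 s sr).
have h2 t : `|t| < r ->
    is_derive t (1 : K) (fun t => p2 (P 0 t)) ('d p2 (P 0 t) v).
  by move=> tr; apply: dt; have [] := dW (rW _ _ zr tr).
have h3 s t : `|s| < r -> `|t| < r ->
    is_derive s (1 : K) (fun s => p3 (P s t)) ('d p3 (P s t) u).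
  by move=> sr tr; apply: ds; have [] := dW (rW _ _ sr tr).
have h4 s t : `|s| < r -> `|t| < r ->
    is_derive t (1 : K) (fun t => p3 (P s t)) ('d p3 (P s t) v).
  by move=> sr tr; apply: dt; have [] := dW (rW _ _ sr tr).
(* The coefficients nu and mu are the values of the third form on v and u, so nu u - mu v lies in
   its kernel. *)
have h5 s t : `|s| < r -> `|t| < r ->
    (al3 * be1 - be3 * al1) * 'd p3 (P s t) u =
    (al3 * be2 - be3 * al2) * 'd p3 (P s t) v.
  move=> sr tr.
  have [_ _ [_ k3]] := kW (rW _ _ sr tr)
    ((al3 * be1 - be3 * al1) *: u - (al3 * be2 - be3 * al2) *: v).
  have : 'd p3 (P s t)
      ((al3 * be1 - be3 * al1) *: u - (al3 * be2 - be3 * al2) *: v) = 0.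
    by apply: k3; rewrite /= !scaleK; ring.
  by rewrite linear_comb => /eqP; rewrite subr_eq0 => /eqP.
have h6 s t : `|s| < r -> `|t| < r ->
    p1 (P s 0) ^+ 2 + p2 (P 0 t) ^+ 2 + p3 (P s t) ^+ 2
    + p1 (P s 0) * p2 (P 0 t) * p3 (P s t)
    - (a1 * p1 (P s 0) + a2 * p2 (P 0 t) + a3 * p3 (P s t) + a4) = 0.
  by move=> sr tr; rewrite -(p1E s t)// -(p2E s t)//; exact: onW (rW _ _ sr tr).
have h7 : 'd p1 (P 0 0) u != 0.
  rewrite P00; have [[k1 _] _ _] := kW Ww0 u.
  apply: contra det12 => /eqP /k1 /= e; apply/eqP; rewrite -[RHS]e; ring.
have h8 : 'd p2 (P 0 0) v != 0.
  rewrite P00; have [_ [k1 _] _] := kW Ww0 v.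
  apply: contra det12 => /eqP /k1 /= e; apply/eqP.
  by rewrite -[RHS]oppr0 -[in RHS]e; ring.
have h9 : 2 * p2 (P 0 0) + p1 (P 0 0) * p3 (P 0 0) - a2 != 0 by rewrite P00.
have := web_curv_eq0 r0 det23 h1 h2 h3 h4 h5 h6 h7 h8 h9.
by rewrite P00.
Unshelve. all: by end_near. Qed.

End Flat.

Lemma loc_parallelizable_curv_eq0 (R : realType) (a1 a2 a3 a4 x1 x2 x3 : R[i]) :
  loc_parallelizable a1 a2 a3 a4 x1 x2 x3 ->
  dF1 a1 a2 a3 a4 x1 x2 x3 != 0 -> dF2 a1 a2 a3 a4 x1 x2 x3 != 0 ->
  dF3 a1 a2 a3 a4 x1 x2 x3 != 0 ->
  web_curv x1 x2 x3 (dF1 a1 a2 a3 a4 x1 x2 x3) (dF2 a1 a2 a3 a4 x1 x2 x3)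
    (dF3 a1 a2 a3 a4 x1 x2 x3) = 0.
Proof.
move=> [W [w0 [p1 [p2 [p3 [al1 [be1 [al2 [be2 [al3 [be3]]]]]]]]]]].
move=> [oW [Ww0 [[<- <- <-] [onW [_ [dW [[n1 n2 n3] kW]]]]]]].
exact: (@flat_web_curv R[i] a1 a2 a3 a4 (@derive_eq0_cst_disc R) W w0 p1 p2 p3
  al1 be1 al2 be2 al3 be3 oW Ww0 onW dW n1 n2 kW).
Qed.

(** * Flat webs on the cubic surfaces *)

Lemma horner_cvg (K : numFieldType) (p : {poly K}) (T : Type)
    (G : set_system T) (FG : Filter G) (f : T -> K) (x : K) :
  f @ G --> x -> (fun t => p.[f t]) @ G --> p.[x].
Proof.
move=> fx; elim/poly_ind: p => [|p c IH].
  under eq_fun do rewrite horner0.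
  by rewrite horner0; exact: cvg_cst.
under eq_fun do rewrite hornerMXaddC.
rewrite hornerMXaddC.
by apply: cvgD; [exact: cvgM|exact: cvg_cst].
Qed.

(** Write p as a power of X - x times a cofactor nonzero at x, hence nonzero near x by
    continuity. *)
Lemma near_horner_neq0 (K : numFieldType) (p : {poly K}) (x : K) :
  p != 0 -> \forall y \near x^', p.[y] != 0.
Proof.
move=> p0; have [m [q]] := multiplicity_XsubC p x.
rewrite p0 /= => qx ->.
have cq : horner q @ x --> q.[x].
  exact: (@horner_cvg K q K (nbhs x) _ id x (@cvg_id _ _)).
have qn : \forall y \near x^', q.[y] != 0.
  apply: nbhs_dnbhs; exact: (@cvgr_neq0 _ _ _ _ _ (horner q) _ cq qx).
near=> y.
rewrite hornerM horner_exp hornerXsubC mulf_neq0 ?expf_neq0//.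
- by near: y.
- by rewrite subr_eq0; near: y; exact: nbhs_dnbhs_neq.
Unshelve. all: by end_near. Qed.

Lemma horner_neq0_exists (K : numFieldType) (p : {poly K}) :
  p != 0 -> exists x, p.[x] != 0.
Proof. by move=> /(near_horner_neq0 0) /filter_ex. Qed.

Lemma poly_eq0_generic (K : numFieldType) (p q : {poly K}) :
  q != 0 -> (forall x, q.[x] != 0 -> p.[x] = 0) -> p = 0.
Proof.
move=> q0 pq; apply/eqP/contraT => p0.
have [x] := horner_neq0_exists (mulf_neq0 p0 q0).
by rewrite hornerM mulf_eq0 negb_or => /andP[px /pq /eqP]; rewrite (negPf px).
Qed.

Lemma Poly_neq0 (K : numFieldType) (s : seq K) (n : nat) :
  s`_n != 0 -> Poly s != 0.
Proof. by apply: contra_neq => s0; rewrite -(coef_Poly s) s0 coef0. Qed.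

Section WebCurvCvg.
Variables (K : numFieldType) (T : Type) (G : set_system T) (FG : Filter G).

Let cM (f g : T -> K) (a b : K) : f @ G --> a -> g @ G --> b ->
  (fun z => f z * g z) @ G --> a * b.
Proof. exact: cvgM. Qed.

Let cD (f g : T -> K) (a b : K) : f @ G --> a -> g @ G --> b ->
  (fun z => f z + g z) @ G --> a + b.
Proof. exact: cvgD. Qed.

Let cB (f g : T -> K) (a b : K) : f @ G --> a -> g @ G --> b ->
  (fun z => f z - g z) @ G --> a - b.
Proof. exact: cvgB. Qed.

Let cN (f : T -> K) (a : K) : f @ G --> a -> (fun z => - f z) @ G --> - a.
Proof. exact: cvgN. Qed.

Lemma web_curv_cvg (x1 x2 x3 f1 f2 f3 : T -> K) (l1 l2 l3 m1 m2 m3 : K) :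
  x1 @ G --> l1 -> x2 @ G --> l2 -> x3 @ G --> l3 ->
  f1 @ G --> m1 -> f2 @ G --> m2 -> f3 @ G --> m3 ->
  (fun z => web_curv (x1 z) (x2 z) (x3 z) (f1 z) (f2 z) (f3 z)) @ G -->
    web_curv l1 l2 l3 m1 m2 m3.
Proof.
have k2 : (fun z : T => 2 : K) @ G --> (2 : K) by exact: cvg_cst.
move=> c1 c2 c3 d1 d2 d3.
have Z1 := cB (cM k2 d3) (cM c2 d1).
have Z2 := cB (cM c3 d3) (cM c1 d1).
have Z3 := cB (cM c2 d3) (cM k2 d1).
have D := cM (cM d1 d2) d3.
have U12 := cD (cM Z1 d2) (cM d1 Z2).
have U23 := cD (cM Z2 d3) (cM d2 Z3).
have U13 := cD (cM Z1 d3) (cM d1 Z3).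
have V1 := cD (cM (cM (cN d1) d2) d3) (cM c3 U23).
have V2 := cB V1 (cM (cM (cM k2 c2) d2) Z2).
have V3 := cB V2 (cM k2 U13).
have V4 := cD V3 (cM (cM d3 d1) d2).
have V5 := cD V4 (cM c1 U12).
have Y1 := cB (cM (cM c3 d2) d3) (cM c2 (cM d2 d2)).
have Y2 := cB Y1 (cM (cM k2 d1) d3).
have Y3 := cD Y2 (cM (cM c1 d1) d2).
have X1 := cD (cM (cM Z1 d2) d3) (cM (cM d1 Z2) d3).
have X2 := cD X1 (cM (cM d1 d2) Z3).
exact: (cB (cM V5 D) (cM Y3 X2)).
Qed.

End WebCurvCvg.

(** * Slices x1 = s of the cubic and their discriminant *)

Section Cubic.
Variables (K : numClosedFieldType) (a1 a2 a3 a4 : K).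
Let S (x1 x2 x3 : K) := x1 ^+ 2 + x2 ^+ 2 + x3 ^+ 2 + x1 * x2 * x3
  - (a1 * x1 + a2 * x2 + a3 * x3 + a4).
Let F1 (x1 x2 x3 : K) := 2 * x1 + x2 * x3 - a1.
Let F2 (x1 x2 x3 : K) := 2 * x2 + x1 * x3 - a2.
Let F3 (x1 x2 x3 : K) := 2 * x3 + x1 * x2 - a3.
Let k := a3 ^+ 2 + 4 * a4.
(** Discriminant of the cubic equation as a quadratic in x3, at x1 = s and x2 = t; it equals F3^2 on
    the surface. *)
Let Delta (s t : K) := (s ^+ 2 - 4) * t ^+ 2 + (4 * a2 - 2 * a3 * s) * t
  + (k - 4 * s ^+ 2 + 4 * a1 * s).

(** [D], [M1] and [M2] are, up to a constant, the resultants in x3 of the cubic with F3, F1 and F2.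
    As polynomials in t their leading coefficients are s^2 - 4, -4 and 4 (s^2 - 4), whence the
    condition on s. *)
Lemma slice_regular_generic (s : K) : s ^+ 2 != 4 ->
  exists2 M : {poly K}, M != 0 & forall t x3, S s t x3 = 0 -> M.[t] != 0 ->
    [/\ F1 s t x3 != 0, F2 s t x3 != 0 & F3 s t x3 != 0].
Proof.
move=> s4.
pose D := Poly [:: k - 4 * s ^+ 2 + 4 * a1 * s; 4 * a2 - 2 * a3 * s; s ^+ 2 - 4].
pose M1 := Poly [:: - (4 * s - 2 * a1) ^+ 2; - 2 * a3 * (4 * s - 2 * a1);
  4 * s ^+ 2 + 4 * a4; 4 * a2; - 4].
pose M2 := Poly [:: - 4 * s ^+ 2 * (s ^+ 2 - a1 * s - a4) + 4 * s * a3 * a2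
  - 4 * a2 ^+ 2; 16 * a2 - 8 * s * a3; 4 * (s ^+ 2 - 4)].
have s40 : s ^+ 2 - 4 != 0 by rewrite subr_eq0.
have n4 : 4 != 0 :> K by rewrite pnatr_eq0.
exists (D * M1 * M2).
  rewrite !mulf_neq0//.
  - exact: (@Poly_neq0 _ _ 2).
  - by apply: (@Poly_neq0 _ _ 4); rewrite /= oppr_eq0.
  - by apply: (@Poly_neq0 _ _ 2); rewrite /= mulf_neq0.
move=> t x3 on; rewrite !hornerM !mulf_eq0 !negb_or => /andP[/andP[d m1] m2].
split.
- apply: contra m1 => /eqP f1; apply/eqP; rewrite horner_Poly /=.
  have e : 2 * F1 s t x3 * (t * F3 s t x3 + (t * (s * t - a3) - 4 * s + 2 * a1))
     - 4 * t ^+ 2 * S s t x3 = 0 by rewrite f1 on; ring.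
  by rewrite -[RHS]e /F1 /F3 /S; ring.
- apply: contra m2 => /eqP f2; apply/eqP; rewrite horner_Poly /=.
  have e : 2 * F2 s t x3 * (s * F3 s t x3 + (s * (s * t - a3) - 4 * t + 2 * a2))
     - 4 * s ^+ 2 * S s t x3 = 0 by rewrite f2 on; ring.
  by rewrite -[RHS]e /F2 /F3 /S; ring.
- apply: contra d => /eqP f3; apply/eqP; rewrite horner_Poly /=.
  have e : F3 s t x3 ^+ 2 - 4 * S s t x3 = 0 by rewrite f3 on; ring.
  by rewrite -[RHS]e /F3 /S /k; ring.
Qed.

Let xs (s t : K) : K := (a3 - s * t + sqrtC (Delta s t)) / 2.

Lemma slice_point (s t : K) : S s t (xs s t) = 0.
Proof.
have e : 4 * S s t (xs s t) = sqrtC (Delta s t) ^+ 2 - Delta s t.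
  by rewrite /S /xs /Delta /k; field.
by apply: (@mulfI _ 4); rewrite ?pnatr_eq0// e sqrtCK subrr mulr0.
Qed.

Lemma exists_regular : exists x1 x2 x3 : K, [/\ S x1 x2 x3 = 0,
  F1 x1 x2 x3 != 0, F2 x1 x2 x3 != 0 & F3 x1 x2 x3 != 0].
Proof.
have s4 : (0 : K) ^+ 2 != 4 by rewrite expr0n/= eq_sym pnatr_eq0.
have [M M0 hM] := slice_regular_generic s4.
have [t Mt] := horner_neq0_exists M0.
exists 0, t, (xs 0 t).
have on := slice_point 0 t.
by have [] := hM _ _ on Mt.
Qed.

(** The chosen square root need not be continuous elsewhere, but at 0 the identity |sqrt z|^2 = |z|
    suffices. Limits along a slice are accordingly taken at zeros of [Delta]. *)
Lemma sqrtC_cvg0 (T : Type) (G : set_system T) (FG : Filter G) (f : T -> K) :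
  f @ G --> (0 : K) -> (fun x => sqrtC (f x)) @ G --> (0 : K).
Proof.
move=> f0; apply/(@cvgrPdist_lt _ K) => e e0.
have e20 : 0 < e ^+ 2 by rewrite exprn_gt0.
near=> x; rewrite sub0r normrN -(@ltr_pXn2r _ 2)// ?nnegrE ?normr_ge0 ?ltW//.
rewrite -normrX sqrtCK -normrN -sub0r.
by near: x; exact: (@cvgr_dist_lt _ K).
Unshelve. all: by end_near. Qed.

Lemma slice_curv_cvg (s t : K) (T : Type) (G : set_system T) (FG : Filter G)
    (f : T -> K) :
  Delta s t = 0 -> f @ G --> t ->
  let y := (a3 - s * t) / 2 in
  (fun z => let x3 := xs s (f z) in
     web_curv s (f z) x3 (F1 s (f z) x3) (F2 s (f z) x3) (F3 s (f z) x3)) @ G -->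
  web_curv s t y (F1 s t y) (F2 s t y) (F3 s t y).
Proof.
move=> D0 tid y.
have cD : (fun z => Delta s (f z)) @ G --> (0 : K).
  rewrite -[X in _ --> X]D0 /Delta.
  apply: cvgD; last exact: cvg_cst.
  apply: cvgD; apply: cvgM; try exact: cvg_cst; last exact: tid.
  by rewrite expr2; under eq_fun do rewrite expr2; apply: cvgM.
have cx : (fun z => xs s (f z)) @ G --> y.
  rewrite /y -[X in X / 2]addr0; apply: cvgM; last exact: cvg_cst.
  apply: cvgD; last exact: sqrtC_cvg0.
  by apply: cvgB; [exact: cvg_cst|apply: cvgM; [exact: cvg_cst|exact: tid]].
apply: web_curv_cvg => //; first exact: cvg_cst.
- apply: cvgB; last exact: cvg_cst.
  by apply: cvgD; [exact: cvg_cst|exact: cvgM].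
- apply: cvgB; last exact: cvg_cst.
  by apply: cvgD; apply: cvgM => //; exact: cvg_cst.
- apply: cvgB; last exact: cvg_cst.
  by apply: cvgD; apply: cvgM => //; exact: cvg_cst.
Qed.

Hypothesis flat : forall x1 x2 x3, S x1 x2 x3 = 0 ->
  F1 x1 x2 x3 != 0 -> F2 x1 x2 x3 != 0 -> F3 x1 x2 x3 != 0 ->
  web_curv x1 x2 x3 (F1 x1 x2 x3) (F2 x1 x2 x3) (F3 x1 x2 x3) = 0.

(** At a zero t of [Delta] the double root y satisfies F3 = 0. Points of the slice near t are
    regular, so the curvature vanishes there and passes to the limit. The last factor is x1 F1 - x2
    F2, from which x3 cancels. *)
Lemma flat_discriminant (s t : K) : s ^+ 2 != 4 -> Delta s t = 0 ->
  let y := (a3 - s * t) / 2 in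
  F1 s t y ^+ 2 * F2 s t y ^+ 2 * (2 * s ^+ 2 - 2 * t ^+ 2 - a1 * s + a2 * t) = 0.
Proof.
move=> s4 D0 y.
have [M M0 hM] := slice_regular_generic s4.
pose W t := let x3 := xs s t in
  web_curv s t x3 (F1 s t x3) (F2 s t x3) (F3 s t x3).
have W0 : \forall t' \near t^', W t' = 0.
  near=> t'.
  have Mt : M.[t'] != 0 by near: t'; exact: near_horner_neq0.
  have [f1 f2 f3] := hM _ _ (slice_point s t') Mt.
  exact: (flat (slice_point s t') f1 f2 f3).
have cW : W @ t^' --> web_curv s t y (F1 s t y) (F2 s t y) (F3 s t y).
  apply: (@slice_curv_cvg s t _ t^' _ id) => //.
  exact: nbhs_dnbhs.
have c0 : W @ t^' --> (0 : K).
  apply: cvg_near_cst W0.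
have /= e := cvg_unique (@norm_hausdorff _ K) cW c0.
have n2 : 2 != 0 :> K by rewrite pnatr_eq0.
apply: (mulfI n2); rewrite mulr0 -e.
have f3 : F3 s t y = 0 by rewrite /F3 /y; field.
by rewrite f3 /web_curv /F1 /F2; field.
Unshelve. all: by end_near. Qed.

(** At a zero of [Delta] with F3 = 0, the t- and s-derivatives of [Delta] are -4 F2 and -4 F1. For
    generic s both roots t are simple, which forces F1 = 0 at each of them; the resulting identities
    in s determine all four parameters. *)
Lemma flat_cayley : [/\ a1 = 0, a2 = 0, a3 = 0 & a4 = 4].
Proof.
(* [d] is the discriminant of [Delta s] and [Rs] the resultant of [Delta s] with
   [x1 F1 - x2 F2], eliminating [t]: modulo the latter, [Delta s t] is
   [al.[s] * t + be.[s]] and [t ^+ 2] is [ga.[s] + a2 / 2 * t]. *)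
pose d : {poly K} := Poly [:: 16 * a2 ^+ 2 + 16 * k; 64 * a1 - 16 * a2 * a3;
  4 * a3 ^+ 2 - 4 * k - 64; - 16 * a1; 16].
pose al : {poly K} := Poly [:: 2 * a2; - 2 * a3; a2 / 2].
pose be : {poly K} := Poly [:: k; 6 * a1; - 8; - (a1 / 2); 1].
pose ga : {poly K} := Poly [:: 0; - (a1 / 2); 1].
pose Rs : {poly K} := be ^+ 2 + ((a2 / 2) *: (al * be) - al ^+ 2 * ga).
pose Q : {poly K} := Poly [:: - 4; 0; 1] * d * Rs.
have n16 : 16 != 0 :> K by rewrite pnatr_eq0.
(* [be] is monic of degree 4, so [be ^+ 2] has degree 8, while the remaining terms have degree at
   most 6. *)
have Rs0 : Rs != 0.
  have sbe : size be = 5 by rewrite (@PolyK _ 0)//= oner_eq0.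
  have sal : (size al <= 3)%N by exact: size_Poly.
  have sga : (size ga <= 3)%N by exact: size_Poly.
  have be0 : be != 0 by rewrite -size_poly_gt0 sbe.
  have sb2 : size (be ^+ 2)%R = 9 by rewrite expr2 size_mul// sbe.
  have sab : (size (al * be)%R <= 7)%N.
    by have := size_polyMleq al be; lia.
  have saa : (size (al ^+ 2)%R <= 5)%N.
    by rewrite expr2; have := size_polyMleq al al; lia.
  have sag : (size (al ^+ 2 * ga)%R <= 7)%N.
    rewrite (leq_trans (size_polyMleq _ _))// -[7%N]/((5 + 3).-1)%N -!subn1.
    by rewrite leq_sub2r// leq_add.
  rewrite -size_poly_gt0 size_polyDl sb2// ltnS.
  rewrite (leq_trans (size_polyD _ _))// geq_max size_polyN.
  by rewrite (leq_trans (size_scale_leq _ _)) (leq_trans sab, leq_trans sag).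
have Q0 : Q != 0.
  rewrite !mulf_neq0//.
  - by apply: (@Poly_neq0 _ _ 2); rewrite /= oner_eq0.
  - exact: (@Poly_neq0 _ _ 4).
have main s : Q.[s] != 0 ->
    2 * a3 * s ^+ 2 - 8 * a2 * s + 8 * a3 = 0 /\
    - 4 * a1 * s ^+ 2 + (32 - 2 * k) * s - 16 * a1 = 0.
  rewrite !hornerM !mulf_eq0 !negb_or => /andP[/andP[s4 ds] Rss].
  have {}s4 : s ^+ 2 - 4 != 0.
    by apply: contra s4 => /eqP e; rewrite horner_Poly; apply/eqP;
      rewrite -[RHS]e /=; ring.
  have s4' : s ^+ 2 != 4 by rewrite -subr_eq0.
  pose de := sqrtC d.[s].
  have de0 : de != 0 by rewrite sqrtC_eq0.
  have deE : de ^+ 2 = (4 * a2 - 2 * a3 * s) ^+ 2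
      - 4 * (s ^+ 2 - 4) * (k - 4 * s ^+ 2 + 4 * a1 * s).
    by rewrite sqrtCK horner_Poly /=; ring.
  have vanish (x y z : K) :
      x ^+ 2 * y ^+ 2 * z = 0 -> y != 0 -> x = 0 \/ z = 0.
    move=> /eqP; rewrite -exprMn mulf_eq0 sqrf_eq0 mulf_eq0 => + /negPf y0.
    by rewrite y0 orbF => /orP[]/eqP; [left|right].
  (* Here e is either square root of the discriminant and t the corresponding root, so e is the
     t-derivative of [Delta] at t and F2 = - e / 4 is nonzero. *)
  have E1 e : e ^+ 2 = de ^+ 2 -> e != 0 ->
      let t := (e - (4 * a2 - 2 * a3 * s)) / (2 * (s ^+ 2 - 4)) in
      Delta s t = 0 /\ s * (2 * t ^+ 2 - 8) - 2 * a3 * t + 4 * a1 = 0.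
    move=> ee e0 t.
    have et : e = 2 * (s ^+ 2 - 4) * t + (4 * a2 - 2 * a3 * s).
      by rewrite /t; field.
    have Dt : Delta s t = 0.
      apply: (mulfI (mulf_neq0 n16 s4)); rewrite mulr0.
      have -> : 16 * (s ^+ 2 - 4) * Delta s t = 4 * (e ^+ 2 - de ^+ 2).
        by rewrite et deE /Delta; ring.
      by rewrite ee subrr mulr0.
    split=> //.
    have := flat_discriminant s4' Dt; cbv zeta.
    have -> : F2 s t ((a3 - s * t) / 2) = - e / 4.
      by rewrite et /F2; field.
    have -> : F1 s t ((a3 - s * t) / 2) =
        - (s * (2 * t ^+ 2 - 8) - 2 * a3 * t + 4 * a1) / 4.
      by rewrite /F1; field.
    have e40 : - e / 4 != 0 by rewrite mulf_neq0 ?oppr_eq0// invr_eq0 pnatr_eq0.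
    move=> /vanish /(_ e40)[/eqP|e2].
      by rewrite mulNr oppr_eq0 mulf_eq0 invr_eq0 pnatr_eq0 orbF => /eqP.
    (* The other factor would make t a common root of [Delta s] and x1 F1 - x2 F2, so the resultant
       would vanish at s. *)
    case/eqP: Rss.
    have hal : al.[s] * t + be.[s] = 0.
      rewrite -[RHS]Dt.
      have -> : Delta s t = Delta s t + (s ^+ 2 - 4) / 2 *
         (2 * s ^+ 2 - 2 * t ^+ 2 - a1 * s + a2 * t) by rewrite e2 mulr0 addr0.
      by rewrite !horner_Poly /Delta /=; field.
    have hga : ga.[s] = t ^+ 2 - a2 / 2 * t.
      rewrite -[RHS]addr0 -[X in _ + X](mul0r 2^-1) -e2.
      by rewrite !horner_Poly /=; field.
    rewrite !(hornerD, hornerN, hornerM, hornerZ, horner_exp) hga.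
    have -> : be.[s] = - al.[s] * t.
      by apply/eqP; rewrite mulNr -addr_eq0 addrC hal.
    by ring.
  have [D1 e1] := E1 de erefl de0.
  have [D2 e2] := E1 (- de) (sqrrN _) ltac:(by rewrite oppr_eq0).
  move: D1 e1 D2 e2.
  set t1 := _ / _; set t2 := (- de - _) / _ => D1 e1 D2 e2.
  have t12 : t1 - t2 != 0.
    have -> : t1 - t2 = de / (s ^+ 2 - 4) by rewrite /t1 /t2; field.
    by rewrite mulf_neq0 ?invr_eq0.
  pose b := 2 * a3 * s ^+ 2 - 8 * a2 * s + 8 * a3.
  pose c := - 4 * a1 * s ^+ 2 + (32 - 2 * k) * s - 16 * a1.
  (* This combination of [Delta] and its s-derivative cancels t^2. The affine function b t + c then
     vanishes at two distinct points, so b = c = 0. *)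
  have lin t : Delta s t = 0 ->
      s * (2 * t ^+ 2 - 8) - 2 * a3 * t + 4 * a1 = 0 -> b * t + c = 0.
    move=> Dt Et.
    have -> : b * t + c = (s ^+ 2 - 4) *
        (s * (2 * t ^+ 2 - 8) - 2 * a3 * t + 4 * a1) - 2 * s * Delta s t.
      by rewrite /b /c /Delta; ring.
    by rewrite Et Dt !mulr0 subrr.
  have b0 : b = 0.
    apply: (mulIf t12); rewrite mul0r mulrBr.
    have := lin _ D1 e1; have := lin _ D2 e2.
    move=> l2 l1; have -> : b * t1 - b * t2 = (b * t1 + c) - (b * t2 + c) by ring.
    by rewrite l1 l2 subrr.
  by split=> //; have := lin _ D1 e1; rewrite b0 mul0r add0r.
have P1 : Poly [:: 8 * a3; - 8 * a2; 2 * a3] = 0.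
  apply: (poly_eq0_generic Q0) => s /main[+ _].
  by rewrite horner_Poly /= => e; rewrite -[RHS]e; ring.
have P2 : Poly [:: - 16 * a1; 32 - 2 * k; - 4 * a1] = 0.
  apply: (poly_eq0_generic Q0) => s /main[_ +].
  by rewrite horner_Poly /= => e; rewrite -[RHS]e; ring.
have nz (c x : K) : c != 0 -> c * x = 0 -> x = 0.
  by move=> c0 /eqP; rewrite mulf_eq0 (negPf c0) => /eqP.
have n8 : 8 != 0 :> K by rewrite pnatr_eq0.
have a30 : a3 = 0.
  by apply: (nz 8) => //; have := coef_Poly [:: 8 * a3; - 8 * a2; 2 * a3] 0%N;
    rewrite P1 coef0.
have a20 : a2 = 0.
  apply: (nz (- 8)); first by rewrite oppr_eq0.
  by have := coef_Poly [:: 8 * a3; - 8 * a2; 2 * a3] 1%N; rewrite P1 coef0.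
have a10 : a1 = 0.
  apply: (nz (- 16)); first by rewrite oppr_eq0.
  by have := coef_Poly [:: - 16 * a1; 32 - 2 * k; - 4 * a1] 0%N;
    rewrite P2 coef0.
split=> //.
have := coef_Poly [:: - 16 * a1; 32 - 2 * k; - 4 * a1] 1%N.
rewrite P2 coef0 /= /k a30 => e.
apply/eqP; rewrite -subr_eq0; apply/eqP; apply: (nz (- 8)).
  by rewrite oppr_eq0.
by rewrite [RHS]e; ring.
Qed.

End Cubic.

(** * The complex exponential *)

Section complex_exponential.
Variable R : realType.
Local Open Scope complex_scope.

Definition expC (z : R[i]) : R[i] :=
  (expR (complex.Re z) * cos (complex.Im z))
  +i* (expR (complex.Re z) * sin (complex.Im z)).

Lemma expCD (z w : R[i]) : expC (z + w) = expC z * expC w.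
Proof.
case: z w => [a b] [c d]; rewrite /expC /= expRD cosD sinD.
by apply/eqP; rewrite eq_complex /=; apply/andP; split; apply/eqP; ring.
Qed.

Lemma expC0 : expC 0 = 1.
Proof. by rewrite /expC /= expR0 cos0 sin0 mulr1 mulr0. Qed.

Lemma expC_neq0 (z : R[i]) : expC z != 0.
Proof.
have : expC z * expC (- z) != 0 by rewrite -expCD subrr expC0 oner_eq0.
by rewrite mulf_eq0 negb_or => /andP[].
Qed.

(** Polar form: the real part of the logarithm is ln r, and the argument is acos (a / r) with the
    sign of b. *)
Lemma expC_surj (z : R[i]) : z != 0 -> exists u, expC u = z.
Proof.
case: z => a b z0.
pose r := Num.sqrt (a ^+ 2 + b ^+ 2).
have ab0 : 0 < a ^+ 2 + b ^+ 2.
  rewrite lt_neqAle addr_ge0 ?sqr_ge0// andbT eq_sym.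
  rewrite paddr_eq0 ?sqr_ge0// !sqrf_eq0.
  by move: z0; rewrite eq_complex.
have r0 : 0 < r by rewrite sqrtr_gt0.
have r2 : r ^+ 2 = a ^+ 2 + b ^+ 2 by rewrite sqr_sqrtr// ltW.
have ar2 : (a / r) ^+ 2 <= 1.
  by rewrite expr_div_n r2 ler_pdivrMr// mul1r lerDl sqr_ge0.
have ar : -1 <= a / r <= 1 by rewrite -ler_norml -sqrtr_sqr -sqrtr1 ler_wsqrtr.
have lr : expR (ln r) = r by rewrite lnK.
have cs : cos (acos (a / r)) = a / r by rewrite acosK// in_itv.
have sn : sin (acos (a / r)) = `|b| / r.
  have -> : `|b| / r = `|b / r| by rewrite normrM normfV (gtr0_norm r0).
  rewrite sin_acos// -sqrtr_sqr; congr Num.sqrt.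
  by rewrite !expr_div_n r2; field; rewrite gt_eqF.
have rn : r != 0 by rewrite gt_eqF.
have [b0|b0] := leP 0 b.
- exists (ln r +i* acos (a / r)); rewrite /expC /= lr cs sn ger0_norm//.
  by rewrite ![r * _]mulrC !divfK.
- exists (ln r +i* - acos (a / r)); rewrite /expC /= lr cosN sinN cs sn ltr0_norm//.
  by rewrite mulNr opprK ![r * _]mulrC !divfK.
Qed.

(** Taking moduli gives Re z = 0; then cos (Im z) = 1 with |Im z| < 1 <= pi, and cos is injective on
    [0, pi]. *)
Lemma expC_eq1_small (z : R[i]) : `|z| < 1 -> expC z = 1 -> z = 0.
Proof.
case: z => a b z1 /eqP; rewrite eq_complex /= => /andP[/eqP ec /eqP es].
have b1 : `|b| < 1.
  by have := le_lt_trans (norm_Im_le (a +i* b)) z1; rewrite (_ : 1 = 1%:C)// ltcR.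
have e2 : expR a ^+ 2 = 1.
  rewrite -[LHS]mulr1 -[X in _ * X](cos2Dsin2 b) mulrDr -!exprMn ec es.
  by rewrite expr1n expr0n addr0.
have ea : expR a = 1.
  move/eqP: e2; rewrite sqrf_eq1 => /orP[/eqP//|/eqP e].
  by have := expR_gt0 a; rewrite e oppr_gt0 ltr10.
have a0 : a = 0 by apply: expR_inj; rewrite ea expR0.
move: ec; rewrite ea mul1r => cb.
have b0 : `|b| = 0.
  have pi1 : 1 <= pi :> R.
    by rewrite (le_trans _ (pi_ge2 R))// ler1n.
  apply: (@cos_inj R); rewrite ?in_itv /= ?lexx ?pi_ge0 ?normr_ge0//.
    by rewrite (le_trans (ltW b1)).
  by rewrite cos_norm cos0.
by rewrite a0; move/eqP: b0; rewrite normr_eq0 => /eqP ->.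
Qed.

Lemma is_derive_near_le (f : R -> R) (d e : R) : 0 < e ->
  is_derive (0 : R) (1 : R) f d ->
  \forall x \near (0 : R), `|f x - f 0 - d * x| <= e * `|x|.
Proof.
move=> e0 [df dE].
have : h^-1 *: ((f \o shift 0) (h *: (1 : R)) - f 0) @[h --> 0^'] --> d.
  by rewrite -[X in _ --> X]dE; exact: df.
move/(@cvgrPdist_le _ R) => /(_ e e0).
rewrite near_withinE => n1.
near=> x.
have [->|x0] := eqVneq x 0; first by rewrite subrr mulr0 subr0 normr0 mulr0.
have : x != 0 -> `|d - x^-1 *: ((f \o shift 0) (x *: (1 : R)) - f 0)| <= e.
  by near: x.
move=> /(_ x0); rewrite /= [x *: _]mulr1 addr0 => h.
have -> : f x - f 0 - d * x = - ((d - x^-1 * (f x - f 0)) * x) by field.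
by rewrite normrN normrM ler_wpM2r.
Unshelve. all: by end_near. Qed.

Lemma Re_cvg0 : (fun z : R[i] => complex.Re z) @ (0 : R[i]) --> (0 : R).
Proof.
apply/(@cvgrPdist_lt _ R _ (nbhs (0 : R[i])) (nbhs_filter _)) => e e0.
have eC : 0 < e%:C by rewrite ltcE /= eqxx.
have n : \forall z \near (0 : R[i]), `|z| < e%:C.
  by apply: near_norm_lt; rewrite normr0.
apply: (@filterS _ (nbhs (0 : R[i])) _ _ _ _ n) => z ze.
by rewrite sub0r normrN -ltcR (le_lt_trans (norm_Re_le z)).
Qed.

Lemma Im_cvg0 : (fun z : R[i] => complex.Im z) @ (0 : R[i]) --> (0 : R).
Proof.
apply/(@cvgrPdist_lt _ R _ (nbhs (0 : R[i])) (nbhs_filter _)) => e e0.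
have eC : 0 < e%:C by rewrite ltcE /= eqxx.
have n : \forall z \near (0 : R[i]), `|z| < e%:C.
  by apply: near_norm_lt; rewrite normr0.
apply: (@filterS _ (nbhs (0 : R[i])) _ _ _ _ n) => z ze.
by rewrite sub0r normrN -ltcR (le_lt_trans (norm_Im_le z)).
Qed.

Lemma norm_complex_le (z : R[i]) :
  `|z| <= (`|complex.Re z| + `|complex.Im z|)%:C.
Proof.
case: z => a b; rewrite normc_def lecR /=.
rewrite -[leRHS]ger0_norm ?addr_ge0// -sqrtr_sqr ler_wsqrtr//.
rewrite sqrrD !real_normK ?num_real//.
by rewrite addrAC lerDl mulrn_wge0 ?mulr_ge0.
Qed.

(** First-order expansions of the real exp, cos and sin give the derivative at 0. The real and
    imaginary parts of the error are each at most 3 e |z|, whence the 6. *)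
Lemma expC_sub1_near (e : R) : 0 < e ->
  \forall z \near (0 : R[i]), `|expC z - 1 - z| <= (6 * e)%:C * `|z|.
Proof.
move=> e0.
have nx : \forall x \near (0 : R), `|expR x - 1 - x| <= e * `|x| /\
    (`|expR x - 1| <= e /\ `|x| <= 1).
  have he : is_derive (0 : R) (1 : R) expR 1.
    exact: (is_derive_eq (is_derive_expR 0) (expR0 R)).
  near=> x; split; [|split].
  - have : `|expR x - expR 0 - 1 * x| <= e * `|x|.
      by near: x; exact: is_derive_near_le.
    by rewrite expR0 mul1r.
  - have : `|expR 0 - expR x| <= e.
      near: x.
      exact: (@cvgr_dist_le _ R _ _ _ _ _ (@continuous_expR R 0) e e0).
    by rewrite distrC expR0.
  - by apply: ltW; near: x; apply: near_norm_lt; rewrite normr0.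
have ny : \forall y \near (0 : R), `|cos y - 1| <= e * `|y| /\
    (`|sin y - y| <= e * `|y| /\ `|sin y - y| <= `|y|).
  have hc : is_derive (0 : R) (1 : R) cos 0.
    by apply: (is_derive_eq (is_derive_cos 0)); rewrite sin0 oppr0.
  have hs : is_derive (0 : R) (1 : R) sin 1.
    by apply: (is_derive_eq (is_derive_sin 0)); rewrite cos0.
  near=> y; split; [|split].
  - have : `|cos y - cos 0 - 0 * y| <= e * `|y|.
      by near: y; exact: is_derive_near_le.
    by rewrite cos0 mul0r subr0.
  - have : `|sin y - sin 0 - 1 * y| <= e * `|y|.
      by near: y; exact: is_derive_near_le.
    by rewrite sin0 mul1r subr0.
  - have : `|sin y - sin 0 - 1 * y| <= 1 * `|y|.
      by near: y; exact: is_derive_near_le.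
    by rewrite sin0 !mul1r subr0.
near=> z.
have : (`|expR (complex.Re z) - 1 - complex.Re z| <= e * `|complex.Re z| /\
    (`|expR (complex.Re z) - 1| <= e /\ `|complex.Re z| <= 1)).
  by near: z; exact: (Re_cvg0 nx).
have : (`|cos (complex.Im z) - 1| <= e * `|complex.Im z| /\
    (`|sin (complex.Im z) - complex.Im z| <= e * `|complex.Im z| /\
     `|sin (complex.Im z) - complex.Im z| <= `|complex.Im z|)).
  by near: z; exact: (Im_cvg0 ny).
have := norm_Re_le z; have := norm_Im_le z.
have -> : `|z| = (complex.Re `|z|)%:C by rewrite RRe_real// normr_real.
rewrite !lecR; set m := complex.Re `|z|; move: m => m.
have eE (w : R[i]) : expC w - 1 - w =
    (expR (complex.Re w) * cos (complex.Im w) - 1 - complex.Re w)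
    +i* (expR (complex.Re w) * sin (complex.Im w) - complex.Im w).
  by case: w => a b; apply/eqP; rewrite eq_complex /= oppr0 addr0 !eqxx.
rewrite eE.
move: (complex.Re z) (complex.Im z) => x y bm am [c1 [s1 s2]] [x1 [x2 x3]].
apply: le_trans (norm_complex_le _) _; rewrite -rmorphM lecR /=.
have cb : `|cos y| <= 1 by rewrite ler_norml cos_geN1 cos_le1.
have sy : `|sin y| <= 2 * `|y|.
  rewrite -[sin y](subrK y) (le_trans (ler_normD _ _))// mulr_natl mulr2n.
  by rewrite lerD2r.
have h1 : `|expR x * cos y - 1 - x| <= e * `|x| + 2 * (e * `|y|).
  have -> : expR x * cos y - 1 - x =
    (expR x - 1 - x) * cos y + (1 + x) * (cos y - 1) by ring.
  rewrite (le_trans (ler_normD _ _))// !normrM lerD//.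
    by rewrite (le_trans (ler_wpM2l _ cb))// mulr1.
  rewrite ler_pM// (le_trans (ler_normD _ _))// normr1.
  by rewrite -[2]/(1 + 1) lerD2l.
have h2 : `|expR x * sin y - y| <= e * (2 * `|y|) + e * `|y|.
  have -> : expR x * sin y - y = (expR x - 1) * sin y + (sin y - y) by ring.
  by rewrite (le_trans (ler_normD _ _))// !normrM lerD// ler_pM.
have ex : e * `|x| <= e * m by rewrite ler_pM2l.
have ey : e * `|y| <= e * m by rewrite ler_pM2l.
lra.
Unshelve. all: by end_near. Qed.

Lemma is_derive_expC (z : R[i]) : is_derive z (1 : R[i]) expC (expC z).
Proof.
suff : h^-1 *: ((expC \o shift z) (h *: (1 : R[i])) - expC z)
    @[h --> 0^'] --> expC z.
  move=> c; split; first by apply/cvg_ex; exists (expC z).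
  exact: (@cvg_lim R[i]).
apply/(@cvgrPdist_le _ R[i]) => e e0.
have e0R : 0 < complex.Re e by move: e0; rewrite ltcE /= => /andP[].
have eE : e = (complex.Re e)%:C by rewrite RRe_real// gtr0_real.
pose m := complex.Re `|expC z|.
have mE : `|expC z| = m%:C by rewrite RRe_real// normr_real.
have m0 : 0 < m by rewrite -ltcR -mE normr_gt0 expC_neq0.
have d0 : 0 < complex.Re e / (6 * m) by rewrite divr_gt0 ?mulr_gt0.
rewrite near_withinE; near=> h => h0.
have hh : `|expC h - 1 - h| <= (6 * (complex.Re e / (6 * m)))%:C * `|h|.
  by near: h; exact: expC_sub1_near.
rewrite /= [h *: _]mulr1 [h^-1 *: _]/(h^-1 * _) expCD.
have -> : expC z - h^-1 * (expC h * expC z - expC z) =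
  - (expC z * h^-1 * (expC h - 1 - h)) by field.
rewrite normrN normrM normrM normfV mE eE.
rewrite (le_trans (ler_wpM2l _ hh))//.
  by rewrite mulr_ge0// ?invr_ge0// ler0c ltW.
have -> : m%:C * `|h|^-1 * ((6 * (complex.Re e / (6 * m)))%:C * `|h|) =
   (m * (6 * (complex.Re e / (6 * m))))%:C * (`|h|^-1 * `|h|).
  by rewrite rmorphM; ring.
rewrite mulVf ?normr_eq0// mulr1 lecR.
suff -> : m * (6 * (complex.Re e / (6 * m))) = complex.Re e by [].
by field; rewrite gt_eqF.
Unshelve. all: by end_near. Qed.

End complex_exponential.

(** * The Cayley cubic *)

Section Cayley.
Variables (K : numClosedFieldType) (E : K -> K).
Hypothesis EP : forall z, is_derive z (1 : K) E (E z).
Hypothesis ED : forall z w, E (z + w) = E z * E w.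
Hypothesis E_neq0 : forall z, E z != 0.
Hypothesis E_surj : forall z : K, z != 0 -> exists u, E u = z.
Hypothesis E_inj : forall z, `|z| < 1 -> E z = 1 -> z = 0.

(** For the exponential [E], [c] is -2 cosh and its derivative [c'] is -2 sinh. *)
Let c u := - (E u + (E u)^-1).
Let c' u := - (E u - (E u)^-1).

Lemma is_derive_cayley u : is_derive u (1 : K) c (c' u).
Proof.
have hE := EP u; have [dE eE] := hE.
have hV : is_derive u (1 : K) (fun z => (E z)^-1) (- (E u)^-1).
  split; first exact: derivableV.
  by rewrite deriveV// eE scaleK; field.
apply: is_derive_eq.
by rewrite /c'; ring.
Qed.

Lemma diff_cayley (L : {linear (K * K)%type -> K}) (w : K * K) : continuous L ->
  differentiable (c \o L) w /\ forall h, 'd (c \o L) w h = L h * c' (L w).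
Proof.
move=> cL.
have [dc ec] := is_derive_cayley (L w).
have dc1 : differentiable c (L w) by exact/derivable1_diffP.
have dL : differentiable L w by exact: linear_differentiable.
split; first exact: differentiable_comp.
move=> h; rewrite diff_comp// diff_lin//= diff1E//=.
by rewrite derive1E ec.
Qed.

Lemma diff_cayley_ker (L : {linear (K * K)%type -> K}) (w : K * K) :
  continuous L -> E (L w + L w) != 1 ->
  forall h, 'd (c \o L) w h = 0 <-> L h = 0.
Proof.
move=> cL Ew h; have [_ ->] := diff_cayley w cL; split; last by move=> ->; rewrite mul0r.
move/eqP; rewrite mulf_eq0 => /orP[/eqP//|].
rewrite oppr_eq0 subr_eq0 => /eqP e.
by case/eqP: Ew; rewrite ED {1}e mulVf.
Qed.

Lemma cayley_on_surface u v :
  c u ^+ 2 + c v ^+ 2 + c (u + v) ^+ 2 + c u * c v * c (u + v)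
  - (0 * c u + 0 * c v + 0 * c (u + v) + 4) = 0.
Proof. by rewrite /c ED; field; rewrite !E_neq0. Qed.

(** The difference of the two values factors through (E u - E v) (E (u + v) - 1), and the second
    factor is excluded. *)
Lemma cayley_inj u v : `|u - v| < 1 -> E (u + v) != 1 -> c u = c v -> u = v.
Proof.
move=> uv1 Euv /eqP; rewrite eqr_opp => /eqP e.
have : (E u - E v) * (E (u + v) - 1) = 0.
  rewrite ED.
  have -> : (E u - E v) * (E u * E v - 1) =
    E u * E v * ((E u + (E u)^-1) - (E v + (E v)^-1)) by field; rewrite !E_neq0.
  by rewrite e subrr mulr0.
move/eqP; rewrite mulf_eq0 [_ - 1 == 0]subr_eq0 (negPf Euv) orbF subr_eq0 => /eqP Ee.
have E0 : E 0 = 1 by apply: (mulfI (E_neq0 0)); rewrite -ED addr0 mulr1.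
apply/eqP; rewrite -subr_eq0; apply/eqP; apply: E_inj => //.
by apply: (mulIf (E_neq0 v)); rewrite -ED subrK Ee mul1r.
Qed.

Lemma cayley_point (x1 x2 x3 : K) :
  x1 ^+ 2 + x2 ^+ 2 + x3 ^+ 2 + x1 * x2 * x3 - 4 = 0 ->
  2 * x1 + x2 * x3 != 0 -> 2 * x2 + x1 * x3 != 0 ->
  exists u v, [/\ x1 = c u, x2 = c v & x3 = c (u + v)] /\
    [/\ E (u + u) != 1, E (v + v) != 1 & E (u + v + (u + v)) != 1].
Proof.
move=> on F1 F2.
have root (x : K) : exists u, x = c u.
  (* A root of p^2 + x p + 1 = 0, the equation that E u must satisfy for c u = x; the other root - x
     - p is its inverse. *)
  pose p := (- x + sqrtC (x ^+ 2 - 4)) / 2.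
  have pE : p * (- x - p) = 1.
    have -> : p * (- x - p) = (x ^+ 2 - sqrtC (x ^+ 2 - 4) ^+ 2) / 4.
      by rewrite /p; field.
    by rewrite sqrtCK; field.
  have p0 : p != 0.
    by apply: contra_eq_neq pE => ->; rewrite mul0r eq_sym oner_eq0.
  have [u Eu] := E_surj p0; exists u; rewrite /c Eu.
  have -> : p^-1 = - x - p by apply: (mulfI p0); rewrite divff.
  by ring.
have E0 : E 0 = 1 by apply: (mulfI (E_neq0 0)); rewrite -ED addr0 mulr1.
have EN z : E (- z) = (E z)^-1.
  by apply: (mulfI (E_neq0 z)); rewrite -ED subrr E0 divff.
have [u x1E] := root x1.
(* With x1 = c u and x2 = c v the cubic is quadratic in x3, with roots c (u + v) and c (u - v);
   replacing v by - v exchanges them and keeps c v. *)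
have [v [x2E x3E]] : exists v, x2 = c v /\ x3 = c (u + v).
  have [v x2E] := root x2.
  have : (x3 - c (u + v)) * (x3 - c (u - v)) = 0.
    rewrite -[RHS]on x1E x2E /c !ED EN; field.
    by rewrite !E_neq0.
  move/eqP; rewrite mulf_eq0 !subr_eq0 => /orP[]/eqP x3E; first by exists v.
  by exists (- v); split=> //; rewrite x2E /c EN invrK addrC.
exists u, v; split=> //.
have nz z : c' z != 0 -> E (z + z) != 1.
  apply: contra_neq => e; rewrite /c'.
  apply: (mulfI (E_neq0 z)); rewrite mulr0 mulrN mulrBr divff// -ED e subrr.
  exact: oppr0.
(* The partial derivatives factor through [c'], so their nonvanishing keeps u, v and u + v off the
   critical points of [c]. *)
have f1 : 2 * x1 + x2 * x3 = c' v * c' (u + v).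
  by rewrite x1E x2E x3E /c /c' ED; field; rewrite !E_neq0.
have f2 : 2 * x2 + x1 * x3 = c' u * c' (u + v).
  by rewrite x1E x2E x3E /c /c' ED; field; rewrite !E_neq0.
move: F1 F2; rewrite f1 f2 !mulf_eq0 !negb_or => /andP[n2 n3] /andP[n1 _].
by split; exact: nz.
Qed.
Let L1 : {linear (K * K)%type -> K} := @fst K K.
Let L2 : {linear (K * K)%type -> K} := @snd K K.
Let L3 : {linear (K * K)%type -> K} := @fst K K \+ @snd K K.

Lemma cayley_parallelization (x1 x2 x3 : K) :
  x1 ^+ 2 + x2 ^+ 2 + x3 ^+ 2 + x1 * x2 * x3 - 4 = 0 ->
  2 * x1 + x2 * x3 != 0 -> 2 * x2 + x1 * x3 != 0 ->
  exists (W : set (K * K)%type) (w0 : (K * K)%type)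
      (p1 p2 p3 : (K * K)%type -> K),
  open W /\ W w0 /\
  [/\ p1 w0 = x1, p2 w0 = x2 & p3 w0 = x3] /\
  (forall w, W w -> p1 w ^+ 2 + p2 w ^+ 2 + p3 w ^+ 2 + p1 w * p2 w * p3 w
    - (0 * p1 w + 0 * p2 w + 0 * p3 w + 4) = 0) /\
  (forall w w', W w -> W w' ->
    [/\ p1 w = p1 w', p2 w = p2 w' & p3 w = p3 w'] -> w = w') /\
  (forall w, W w -> [/\ differentiable p1 w, differentiable p2 w,
      differentiable p3 w & forall h : (K * K)%type,
      [/\ 'd p1 w h = 0, 'd p2 w h = 0 & 'd p3 w h = 0] -> h = 0]) /\
  (forall w, W w -> forall h : (K * K)%type,
    [/\ 'd p1 w h = 0 <-> 1 * h.1 + 0 * h.2 = 0,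
        'd p2 w h = 0 <-> 0 * h.1 + 1 * h.2 = 0 &
        'd p3 w h = 0 <-> 1 * h.1 + 1 * h.2 = 0]).
Proof.
move=> on F1 F2.
have [u [v [[e1 e2 e3] [Eu Ev Euv]]]] := cayley_point on F1 F2.
have cL1 : continuous L1 by move=> w; exact: cvg_fst.
have cL2 : continuous L2 by move=> w; exact: cvg_snd.
have cL3 : continuous L3 by move=> w; apply: cvgD; [exact: cL1|exact: cL2].
have nE z : E z != 1 -> \forall y \near z, E y != 1.
  move=> Ez; have [dE _] := EP z.
  have cE : E @ z --> E z.
    by apply: differentiable_continuous; exact/derivable1_diffP.
  have cB : (fun y => E y - 1) @ z --> E z - 1.
    by apply: (@cvgB _ _ _ (nbhs z)); [exact: cE|exact: (@cvg_cst K 1 _ (nbhs z))].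
  have := @cvgr_neq0 _ K _ (nbhs z) (nbhs_filter z) _ _ cB.
  rewrite subr_eq0 => /(_ Ez); apply: (@filterS _ (nbhs z)) => y.
  by rewrite subr_eq0.
have [r r0 rP] : exists2 r : K, 0 < r & forall z, `|z| < r ->
    [/\ E (u + u + z) != 1, E (v + v + z) != 1,
      E (u + v + (u + v) + z) != 1 & `|z| < 1].
  have sh a : E a != 1 -> \forall z \near (0 : K), E (a + z) != 1.
    move=> /nE n.
    have : (fun z => a + z) @ (0 : K) --> a.
      rewrite -[X in _ --> X]addr0.
      by apply: (@cvgD _ _ _ (nbhs (0 : K)));
        [exact: (@cvg_cst K a _ (nbhs 0))|exact: cvg_id].
    by move/(_ _ n).
  have n1 : \forall z \near (0 : K), `|z| < 1.
    by apply: near_norm_lt; rewrite normr0.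
  have F0 := nbhs_filter (0 : K).
  have nn := @filterI _ _ F0 _ _ (@filterI _ _ F0 _ _ (sh _ Eu) (sh _ Ev))
    (@filterI _ _ F0 _ _ (sh _ Euv) n1).
  have /nbhs_ballP[r /= r0 hr] := nn; exists r => // z zr.
  have /hr[[? ?] [? ?]] : ball (0 : K) r z by rewrite -ball_normE /= sub0r normrN.
  by split.
(* With radius r / 4, the sum of coordinates from two points of the ball moves by less than r / 2,
   and the double of w.1 + w.2 by less than r. *)
have r4 : 0 < r / 4 by rewrite divr_gt0.
pose W := ball ((u, v) : (K * K)%type) (r / 4).
have WP w : W w -> `|u - w.1| < r / 4 /\ `|v - w.2| < r / 4.
  by case => /=; rewrite -!ball_normE.
have small (a b a' b' : K) : `|a - a'| < r / 4 -> `|b - b'| < r / 4 ->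
    `|a' + b' - (a + b)| < r / 2.
  move=> h h'; have -> : a' + b' - (a + b) = (a' - a) + (b' - b) by ring.
  rewrite (le_lt_trans (ler_normD _ _))//.
  have -> : r / 2 = r / 4 + r / 4 by field.
  by rewrite ltrD // distrC.
have r2r : r / 2 < r by rewrite ltr_pdivrMr// ltr_pMr// ltr1n.
have shift (a z : K) : z = a + (z - a) by ring.
exists W, (u, v), (c \o L1), (c \o L2), (c \o L3).
(* Two points are allowed because injectivity compares distinct points; w = w' gives the
   nonvanishing of the derivative. *)
have W1 w w' : W w -> W w' -> E (w.1 + w'.1) != 1.
  move=> /WP[h _] /WP[h' _]; rewrite (shift (u + u) (w.1 + w'.1)).
  by have [] := rP _ (lt_trans (small _ _ _ _ h h') r2r).
have W2 w w' : W w -> W w' -> E (w.2 + w'.2) != 1.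
  move=> /WP[_ h] /WP[_ h']; rewrite (shift (v + v) (w.2 + w'.2)).
  by have [] := rP _ (lt_trans (small _ _ _ _ h h') r2r).
have W3 w : W w -> E (w.1 + w.2 + (w.1 + w.2)) != 1.
  move=> /WP[h h']; rewrite (shift (u + v + (u + v)) (_ + (w.1 + w.2))).
  have hh := small _ _ _ _ h h'.
  suff /rP[] : `|w.1 + w.2 + (w.1 + w.2) - (u + v + (u + v))| < r by [].
  have -> : w.1 + w.2 + (w.1 + w.2) - (u + v + (u + v)) =
    (w.1 + w.2 - (u + v)) + (w.1 + w.2 - (u + v)) by ring.
  rewrite (le_lt_trans (ler_normD _ _))// [ltRHS](_ : r = r / 2 + r / 2).
    by rewrite ltrD.
  by field.
have ker w (Ww : W w) h :
    [/\ 'd (c \o L1) w h = 0 <-> h.1 = 0, 'd (c \o L2) w h = 0 <-> h.2 = 0 &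
        'd (c \o L3) w h = 0 <-> h.1 + h.2 = 0].
  split; first exact: (diff_cayley_ker cL1 (W1 _ _ Ww Ww)).
    exact: (diff_cayley_ker cL2 (W2 _ _ Ww Ww)).
  exact: (diff_cayley_ker cL3 (W3 _ Ww)).
split; first exact: ball_open.
split; first exact: ballxx.
split; first by rewrite e1 e2 e3.
split; first by move=> w _; exact: cayley_on_surface.
split.
  have dist (a b b' : K) : `|a - b| < r / 4 -> `|a - b'| < r / 4 -> `|b - b'| < 1.
    move=> h h'; have /rP[] // : `|b - b'| < r.
    rewrite (lt_trans _ r2r)// -[b - b'](subrKA a) (le_lt_trans (ler_normD _ _))//.
    have -> : r / 2 = r / 4 + r / 4 by field.
    by rewrite ltrD // distrC.
  move=> w w' Ww Ww' [/= i1 i2 _].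
  have [h1 h2] := WP _ Ww; have [h1' h2'] := WP _ Ww'.
  have j1 : w.1 = w'.1 by apply: cayley_inj i1 => //; [exact: dist h1 h1'|exact: W1].
  have j2 : w.2 = w'.2 by apply: cayley_inj i2 => //; [exact: dist h2 h2'|exact: W2].
  by case: w w' {Ww Ww' i1 i2 h1 h2 h1' h2'} j1 j2 => [? ?] [? ?] /= -> ->.
split.
  move=> w Ww; split.
  - by have [] := diff_cayley w cL1.
  - by have [] := diff_cayley w cL2.
  - by have [] := diff_cayley w cL3.
  move=> h [d1 d2 _]; have [[k1 _] [k2 _] _] := ker w Ww h.
  by move: (k1 d1) (k2 d2); case: h {d1 d2 k1 k2} => [? ?] /= -> ->.
by move=> w Ww h; rewrite !mul1r !mul0r addr0 add0r; exact: ker.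
Qed.

End Cayley.

(** * Regularity through partial derivatives, and the equivalence *)

Lemma web_regular_neq0 (R : realType) (a1 a2 a3 a4 x1 x2 x3 : R[i]) :
  web_regular a1 a2 a3 a4 x1 x2 x3 <->
  [/\ onS a1 a2 a3 a4 x1 x2 x3, dF1 a1 a2 a3 a4 x1 x2 x3 != 0,
    dF2 a1 a2 a3 a4 x1 x2 x3 != 0 & dF3 a1 a2 a3 a4 x1 x2 x3 != 0].
Proof.
rewrite /web_regular /smooth_pt /tangent.
move: (dF1 _ _ _ _ _ _ _) (dF2 _ _ _ _ _ _ _) (dF3 _ _ _ _ _ _ _) => f1 f2 f3.
have n10 : (1 : R[i]) <> 0 by apply/eqP; rewrite oner_eq0.
split.
  (* If F_i = 0, the i-th basis vector is tangent and is killed by the other two dx_j, against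
     transversality. *)
  move=> [[on _] t]; split=> //; apply/eqP => f0; apply: n10.
  - by have [|_ _] := t 1 0 0; [rewrite f0 !mulr0 mul0r !addr0|apply].
  - by have [|_ + _] := t 0 1 0; [rewrite f0 !mulr0 mul0r !addr0|apply].
  - by have [|+ _ _] := t 0 0 1; [rewrite f0 !mulr0 mul0r !addr0|apply].
move=> [on n1 n2 n3]; split.
  by split=> // -[/eqP]; rewrite (negPf n1).
move=> v1 v2 v3 t; split=> -[z1 z2]; move: t; rewrite z1 z2 !mulr0 ?addr0 ?add0r;
  by move/eqP; rewrite mulf_eq0 ?(negPf n1) ?(negPf n2) ?(negPf n3) => /eqP.
Qed.

Theorem theorem1p1 (R : realType) (a1 a2 a3 a4 : R[i]) :
  (exists x1 x2 x3 : R[i], web_regular a1 a2 a3 a4 x1 x2 x3) /\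
  ((forall x1 x2 x3 : R[i], web_regular a1 a2 a3 a4 x1 x2 x3 ->
      loc_parallelizable a1 a2 a3 a4 x1 x2 x3)
   <-> [/\ a1 = 0, a2 = 0, a3 = 0 & a4 = 4%:R]).
Proof.
split.
  have [x1 [x2 [x3 h]]] := @exists_regular R[i] a1 a2 a3 a4.
  by exists x1, x2, x3; apply/web_regular_neq0.
split=> [par|].
  apply: (@flat_cayley R[i] a1 a2 a3 a4) => x1 x2 x3 on n1 n2 n3.
  apply: (@loc_parallelizable_curv_eq0 R a1 a2 a3 a4) => //.
  by apply: par; apply/web_regular_neq0.
move=> [-> -> -> ->] x1 x2 x3 /web_regular_neq0[on n1 n2 n3].
have on' : x1 ^+ 2 + x2 ^+ 2 + x3 ^+ 2 + x1 * x2 * x3 - 4 = 0.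
  by rewrite -[RHS]on /Fa !mul0r !add0r.
have n1' : 2 * x1 + x2 * x3 != 0 by move: n1; rewrite /dF1 subr0.
have n2' : 2 * x2 + x1 * x3 != 0 by move: n2; rewrite /dF2 subr0.
have [W [w0 [p1 [p2 [p3 [oW [Ww [ew [onW [inj [dW kW]]]]]]]]]]] :=
  @cayley_parallelization R[i] (@expC R) (@is_derive_expC R) (@expCD R)
    (@expC_neq0 R) (@expC_surj R) (@expC_eq1_small R) _ _ _ on' n1' n2'.
exists W, w0, p1, p2, p3, 1, 0, 0, 1, 1, 1.
do ![split=> //].
- by move=> /(congr1 fst) /= /eqP; rewrite oner_eq0.
- by move=> /(congr1 snd) /= /eqP; rewrite oner_eq0.
- by move=> /(congr1 fst) /= /eqP; rewrite oner_eq0.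
Qed.
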